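(* Let $\alpha>0$ and $c>0$, and let $\mu$ be the probability distribution on $\mathbb{R}$ with density $f(x)=\alpha\, c^{\alpha}|x|^{-\alpha-1}$ for $x<-c$ and $f(x)=0$ for $x\geq -c$. Let $(X_i)_{i\in\mathbb{N}}$ be a sequence of independent and identically distributed random variables with distribution $\mu$, defined on a probability space $(\Omega,\mathcal{F},\mathbb{P})$, and for $n\in\mathbb{N}$ let $$\mathrm{w}_n^* := \int_0^1 \big(|F_n^{-1}(u)-F^{-1}(u)|\wedge 1\big)^2\,du ,$$ where $F^{-1}$ is the quantile function of $\mu$ and $F_n^{-1}$ is the empirical quantile function of the sample $X_1,\dots,X_n$. Then for any $\kappa$ with $$0<\kappa<\frac{\alpha}{\alpha+2}$$ there exists a sequence of non-negative random variables $(\mathcal{E}_{\kappa,n})_{n\in\mathbb{N}}$ on the same probability space such that for all $n\in\mathbb{N}$ $$n^{\kappa}\,\mathrm{w}_n^*\leq \mathcal{E}_{\kappa,n}\qquad \mathbb{P}\text{-almost surely},$$ and such that $\mathcal{E}_{\kappa,n}$ converges in distribution, $$\mathcal{E}_{\kappa,n}\stackrel{d}{\longrightarrow} c^2\int_0^1\big(u^{\frac{1}{\alpha}-1}B_u\big)^2\,du\qquad\text{as } n\to\infty,$$ where $B=(B_u)_{u\in[0,1]}$ is a standard Brownian motion.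
   Context: Notation: $a\wedge b=\min(a,b)$. $F(x)=\mu((-\infty,x])$ is the distribution function of $\mu$, and its quantile function is $F^{-1}(u)=\inf\{x\in\mathbb{R}: F(x)\geq u\}$ for $u\in(0,1)$. The empirical distribution function of the sample $X_1,\dots,X_n$ is $F_n(x)=\frac1n\sum_{i=1}^n \mathbf{1}\{X_i\leq x\}$, and the empirical quantile function is $F_n^{-1}(u)=\inf\{x\in\mathbb{R}:F_n(x)\geq u\}=X_{\lceil nu\rceil:n}$ for $0<u\leq 1$, where $X_{1:n}\leq\cdots\leq X_{n:n}$ are the order statistics of the sample. The quantity $\mathrm{w}_n^*$ is a random variable depending on the sample; it is the truncated (cutoff at $1$) empirical Wasserstein statistic of order $2$ between the empirical measure and $\mu$. The stated limit in distribution refers to the law of the random variable on the right-hand side. *)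

(* Defs.v *)
From HB Require Import structures.
From mathcomp Require Import all_boot all_order all_algebra.
From mathcomp Require Import all_classical all_reals all_analysis.

Set Implicit Arguments.
Unset Strict Implicit.
Unset Printing Implicit Defensive.

Import Order.TTheory GRing.Theory Num.Theory.
Import numFieldNormedType.Exports.

Local Open Scope classical_set_scope.
Local Open Scope ring_scope.

Section probability_notions.
Context {d : measure_display} {T : measurableType d} {R : realType}.
Variable P : probability T R.

(** Mutual independence of a family: the product rule on every finite
    subfamily (the duplicate-free sequence [s]). *)
Definition mutually_independent (I : eqType) (X : I -> T -> R) : Prop :=
  forall (s : seq I) (A : I -> set R),
    uniq s -> (forall i, measurable (A i)) ->
    P (\bigcap_(i in [set` s]) (X i @^-1` A i)) =
    (\prod_(i <- s) P (X i @^-1` A i))%E.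

(** Weak convergence of the laws, tested on bounded continuous functions; the
    limit variable [Y] may live on another probability space. Expectations are
    only meaningful for measurable variables, hence the first conjunct. *)
Definition cvg_in_distribution (d' : measure_display) (T' : measurableType d')
    (P' : probability T' R) (X : nat -> {RV P >-> R}) (Y : T' -> R) : Prop :=
  measurable_fun [set: T'] Y /\
  forall f : R -> R, continuous f -> bounded_fun f ->
    ('E_P[f \o X n] @[n --> \oo] --> 'E_P'[f \o Y])%E.

(** Standard Brownian motion on the time interval [0, 1]; the values of [B] at
    other times are irrelevant. The second parameter of [normal_prob] is the
    standard deviation. *)
Record standard_brownian_motion (B : R -> {RV P >-> R}) : Prop := {
  brownian_start : {ae P, forall w, B 0 w = 0} ;
  brownian_indep : forall (n : nat) (t : nat -> R),
    (forall i, (i <= n)%N -> 0 <= t i <= 1) ->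
    (forall i, (i < n)%N -> t i <= t i.+1) ->
    mutually_independent
      (fun (i : 'I_n) (w : T) => B (t i.+1) w - B (t i) w) ;
  brownian_normal : forall s t : R, 0 <= s -> s < t -> t <= 1 ->
    forall A : set R, measurable A ->
      P ((fun w => B t w - B s w) @^-1` A) =
      normal_prob 0 (Num.sqrt (t - s)) A ;
  brownian_continuous : forall w : T,
    {within `[0, 1], continuous (fun u : R => B u w)}
}.

End probability_notions.

Arguments standard_brownian_motion {d T R} P B.
Arguments cvg_in_distribution {d T R} P {d' T'} P' X Y.

Section quantiles.
Context {R : realType}.

Definition dist_fun (mu : probability R R) (x : R) : R :=
  fine (mu `]-oo, x]%classic).

(** Meaningful for [0 < u < 1]: outside, the set may be empty or unbounded
    below, and then [inf] is the default value [0]. *)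
Definition quantile (F : R -> R) (u : R) : R := inf [set x | u <= F x].

(** The sample of size [n] consists of the first [n] terms of the sequence [x],
    numbered from [0]. *)
Definition empirical_dist_fun (x : nat -> R) (n : nat) (y : R) : R :=
  n%:R^-1 * \sum_(i < n) (x i <= y)%R%:R.

(** Truncated (cutoff at 1) Wasserstein statistic of order 2. *)
Definition wstar (mu : probability R R) (x : nat -> R) (n : nat) : R :=
  \int[lebesgue_measure]_(u in `]0, 1[)
    (Num.min `|quantile (empirical_dist_fun x n) u
               - quantile (dist_fun mu) u| 1) ^+ 2.

Definition neg_pareto_pdf (alpha c x : R) : R :=
  if x < - c then alpha * c `^ alpha * `|x| `^ (- alpha - 1) else 0.

(** The almost surely finite variable [c^2 \int_0^1 (u^(1/alpha-1) B_u)^2 du];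
    on the null event where the integral diverges its value is [0]. *)
Definition weighted_brownian_integral (T : Type) (alpha c : R)
    (B : R -> T -> R) (w : T) : R :=
  c ^+ 2 * \int[lebesgue_measure]_(u in `]0, 1[)
             (u `^ (alpha^-1 - 1) * B u w) ^+ 2.

End quantiles.

(* Main.v *)
From HB Require Import structures.
Require Import Defs.
From mathcomp Require Import all_boot all_order all_algebra.
From mathcomp Require Import all_classical all_reals all_analysis.
From mathcomp Require Import measurable_realfun.
From mathcomp Require Import ring lra.

Import Order.TTheory GRing.Theory Num.Theory.
Import numFieldNormedType.Exports.

Set Implicit Arguments.
Unset Strict Implicit.
Unset Printing Implicit Defensive.

Local Open Scope classical_set_scope.
Local Open Scope ring_scope.

(** The bound [kappa < alpha / (alpha + 2)] makes [n^kappa * w_n] tend to 0 in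
    mean, [w_n] being the truncated statistic. The statistic therefore has no
    influence on the limit, and the dominating sequence can be any variable [V]
    with the law of the limit plus a vanishing correction:
    [E_n = V + max (n^kappa * w_n) (n^-eta)].

    Rate of [w_n]. Let [q] be the quantile function of the law and [q_n] that of
    the sample. Chebyshev's inequality for the number of sample points below a
    level, with a lower bound for the growth of the distribution function
    ([pareto_increment]), gives for [0 < s <= 1] the weak tail
    [P (|q_n u - q u| > s) <= C u^-(1 + 2 / alpha) / (n s^2)]
    ([quantile_deviation]). A probability is at most 1, so this bound may be
    raised to any power [theta < 1]; the layer-cake formula then shows that the
    truncated squared deviation at [u] has mean of order
    [(u^-(1 + 2 / alpha) / n)^theta] ([expectation_weak_tail]). This is
    integrable in [u] precisely when [theta < alpha / (alpha + 2)], so that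
    Tonelli's theorem yields [E w_n = O(n^-theta)] for all such [theta]
    ([mean_wstar_le]), and one of them exceeds [kappa].

    The variable [V]. The limit law is that of the weighted integral of any
    Brownian motion. If there is no Brownian motion at all, the convergence
    claim is vacuous. Otherwise the law is well defined: the integral is an
    iterated limit of functions of the path on finite grids, and the laws on a
    grid are determined by the axioms of Brownian motion
    ([weighted_brownian_law]). The probability integral transform of the first
    sample point is a uniform variable on the given probability space
    ([pareto_uniform]), and a uniform variable carries every law on the line
    ([inverse_sampling]).

    Convergence of [E_n]. By Markov's inequality [E_n] coincides with
    [V + n^-eta] outside of an event of vanishing probability, and
    [V + n^-eta] converges to [V] everywhere; dominated convergence concludes
    ([cvg_law_max_error]). *)

(** * Quantiles and distribution functions *)

Definition RV_of {d d' : measure_display} {T : measurableType d}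
    {T' : measurableType d'} {R : realType} (P : probability T R)
    (f : T -> T') (mf : measurable_fun [set: T] f) : {RV P >-> T'} :=
  HB.pack_for {mfun T >-> T'} f (@isMeasurableFun.Build _ _ _ _ f mf).
Arguments RV_of {d d' T T' R} P {f} mf.

Section quantile_facts.
Context {R : realType}.
Implicit Types (F : R -> R) (u x : R).

(** The superlevel set of a nondecreasing, right-continuous function is a closed
    half-line, so that its infimum belongs to it. Right-continuity enters in the form that
    the set where [F] is less than [u] is open to the right. *)
Lemma quantile_leP F u x : {homo F : y z / y <= z} ->
  (forall y, F y < u -> exists2 e, 0 < e & F (y + e) < u) ->
  (exists y, F y < u) -> (exists y, u <= F y) ->
  (quantile F u <= x) = (u <= F x).
Proof.
move=> ndF rcF [y0 Fy0] [y1 Fy1].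
have lbF y : F y < u -> lbound [set x | u <= F x] y.
  move=> Fy z /= uz; rewrite leNgt; apply/negP => zy.
  by move: (lt_le_trans Fy uz); rewrite ltNge ndF// ltW.
apply/idP/idP => [|ux].
- rewrite leNgt => /negP H; rewrite leNgt; apply/negP => Fx; apply: H.
  have [e e0 Fe] := rcF _ Fx.
  rewrite (@lt_le_trans _ _ (x + e))// ?ltrDl//.
  by apply: lb_le_inf; [exists y1|exact: lbF].
- by apply: ge_inf => //; exists y0; exact: lbF.
Qed.

Lemma dist_fun_homo (nu : probability R R) : {homo dist_fun nu : y z / y <= z}.
Proof.
move=> y z yz; rewrite /dist_fun fine_le ?fin_num_measure//.
by rewrite le_measure ?inE//; exact: subitvPr.
Qed.

Lemma dist_fun_ge0 (nu : probability R R) y : 0 <= dist_fun nu y.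
Proof. by rewrite /dist_fun fine_ge0. Qed.

Lemma dist_fun_le1 (nu : probability R R) y : dist_fun nu y <= 1.
Proof.
rewrite /dist_fun -lee_fin fineK ?fin_num_measure//.
exact: probability_le1.
Qed.

Lemma dist_funE (nu : probability R R) y :
  nu `]-oo, y]%classic = (dist_fun nu y)%:E.
Proof. by rewrite /dist_fun fineK ?fin_num_measure. Qed.

Lemma dist_fun_quantile_le (nu : probability R R) u x : 0 < u < 1 ->
  (quantile (dist_fun nu) u <= x) = (u <= dist_fun nu x).
Proof.
move=> /andP[u0 u1].
pose I : {RV nu >-> R} := RV_of nu (@measurable_id _ R setT).
have cE r : cdf I r = (dist_fun nu r)%:E.
  by rewrite /cdf /distribution /pushforward preimage_id dist_funE.
apply: quantile_leP; first exact: dist_fun_homo.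
- move=> y Fy.
  have h : fine (cdf I r) @[r --> y^'+] --> dist_fun nu y.
    by apply: fine_cvg; rewrite -cE; exact: cdf_right_continuous.
  have /nbhs_right0P h' : \forall r \near y^'+, fine (cdf I r) < u.
    exact: (cvgr_lt _ h).
  near (0:R)^'+ => e; exists e => //.
  by have : fine (cdf I (y + e)) < u; [near: e|rewrite cE].
- have h : fine (cdf I r) @[r --> -oo] --> (0:R).
    by apply: fine_cvg; exact: cvg_cdfNy0.
  have h' : \forall r \near -oo, fine (cdf I r) < u by exact: (cvgr_lt _ h).
  near (-oo : set_system R) => r; exists r.
  by have : fine (cdf I r) < u; [near: r|rewrite cE].
- have h : fine (cdf I r) @[r --> +oo] --> (1:R).
    by apply: fine_cvg; exact: cvg_cdfy1.
  have h' : \forall r \near +oo, u < fine (cdf I r) by exact: (cvgr_gt _ h).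
  near (+oo : set_system R) => r; exists r; apply: ltW.
  by have : u < fine (cdf I r); [near: r|rewrite cE].
Unshelve. all: by end_near. Qed.

(** The open right half-lines form a pi-system that generates the Borel sets. *)
Lemma eq_dist_fun_measure (nu1 nu2 : probability R R) :
  dist_fun nu1 = dist_fun nu2 ->
  forall A, measurable A -> nu1 A = nu2 A.
Proof.
move=> e A mA.
apply: (@measure_unique _ _ _ (@RGenOInfty.G R)
  (fun n => `](- n%:R), +oo[%classic) _ _ _ _ nu1 nu2) => //.
- exact: RGenOInfty.measurableE.
- move=> _ _ [x ->] [y ->]; exists (Num.max x y).
  by apply/seteqP; split => z /=; rewrite !in_itv/= !andbT gt_max => /andP.
- by move=> n; exists (- n%:R).
- apply/seteqP; split => // x _; exists (Num.truncn `|x|).+1 => //=.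
  by rewrite in_itv/= andbT ltrNl (le_lt_trans (ler_norm _))// normrN truncnS_gt.
- have rayE (nu : probability R R) x :
      nu `]x, +oo[%classic = (1 - (dist_fun nu x)%:E)%E.
    by rewrite -setCitvl probability_setC// dist_funE.
  by move=> _ [x ->]; rewrite [LHS]rayE [RHS]rayE e.
- by move=> n; rewrite -ge0_fin_numE// fin_num_measure.
Qed.
End quantile_facts.

(** * The Pareto law on the negative half-line *)

Section pareto.
Context {R : realType}.
Variables (alpha c : R) (alpha0 : 0 < alpha) (c0 : 0 < c).

Lemma cvg_powRN_pinfty (p : R) : 0 < p -> y `^ (- p) @[y --> +oo] --> (0 : R).
Proof.
move=> p0; under eq_fun do rewrite powRN.
apply/gtr0_cvgV0; first by near=> y; rewrite powR_gt0.
apply/cvgryPge => A; near=> y.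
have A1 : 0 <= `|A| by [].
rewrite (le_trans (ler_norm A))//.
rewrite -(powRr1 A1) -(mulVf (lt0r_neq0 p0)) powRrM.
by rewrite ge0_ler_powR ?nnegrE ?powR_ge0// ltW.
Unshelve. all: by end_near. Qed.

Lemma continuous_powR_gt0 (p x : R) : 0 < x -> {for x, continuous (fun y => y `^ p)}.
Proof.
move=> x0; apply: differentiable_continuous; apply/derivable1_diffP.
by apply: derivable_powR; rewrite in_itv/= x0.
Qed.

(** An antiderivative is [- c^alpha * y^-alpha], which vanishes at infinity. *)
Lemma integral_pareto_tail (a : R) : 0 < a ->
  (\int[lebesgue_measure]_(y in `[a, +oo[)
     (alpha * c `^ alpha * y `^ (- alpha - 1))%:E)%E =
  ((c / a) `^ alpha)%:E.
Proof.
move=> a0.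
pose F (y : R) : R := - c `^ alpha * y `^ (- alpha).
have dF (y : R) : 0 < y -> is_derive y 1 F (alpha * c `^ alpha * y `^ (- alpha - 1)).
  move=> y0.
  have d1 : is_derive y 1 (fun y : R => y `^ (- alpha)) (- alpha * y `^ (- alpha - 1)).
    apply: DeriveDef; first by apply: derivable_powR; rewrite in_itv/= y0.
    by rewrite -derive1E powR_derive1// in_itv/= y0.
  apply: is_derive_eq; rewrite /GRing.scale/=; ring.
rewrite (@ge0_continuous_FTC2y _ _ F a 0).
- rewrite -EFinB sub0r; congr (_%:E); rewrite /F.
  rewrite mulNr opprK powRM ?invr_ge0 ?ltW//; congr (_ * _).
  by rewrite -powR_inv1 ?ltW// -powRrM mulN1r.
- by move=> x ax; rewrite !mulr_ge0 ?powR_ge0// ltW.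
- apply: continuous_in_subspaceT => x; rewrite inE/= in_itv/= andbT => ax.
  apply: cvgM; first exact: cvg_cst.
  by apply: continuous_powR_gt0; exact: lt_le_trans ax.
- rewrite /F -[X in _ --> X](mulr0 (- c `^ alpha)).
  by apply: cvgM; [exact: cvg_cst|exact: cvg_powRN_pinfty].
- by move=> x ax; have [] := dF _ (lt_trans a0 ax).
- apply: cvg_at_right_filter; apply: cvgM; first exact: cvg_cst.
  exact: continuous_powR_gt0.
- move=> x; rewrite in_itv/= andbT => ax.
  by rewrite derive1E; have [_] := dF _ (lt_trans a0 ax).
Qed.

Variable mu : probability R R.
Hypothesis mu_density : forall A : set R, measurable A ->
  mu A = (\int[lebesgue_measure]_(x in A) (neg_pareto_pdf alpha c x)%:E)%E.

Lemma dist_fun_pareto x : x < - c -> dist_fun mu x = (c / - x) `^ alpha.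
Proof.
move=> xc; apply: EFin_inj; rewrite -dist_funE mu_density//.
have x0 : 0 < - x by rewrite oppr_gt0 (lt_trans xc)// oppr_lt0.
pose G y : R := alpha * c `^ alpha * (- y) `^ (- alpha - 1).
transitivity (\int[lebesgue_measure]_(y in `]-oo, x]) (G y)%:E)%E.
  apply: eq_integral => y; rewrite inE/= in_itv/= => yx; congr (_%:E).
  have yc := le_lt_trans yx xc.
  by rewrite /neg_pareto_pdf yc ltr0_norm// (lt_trans yc)// oppr_lt0.
rewrite -integral_pareto_tail// -[in LHS](opprK x) ge0_integration_by_substitutionNy.
- by apply: eq_integral => y _; rewrite /= /G opprK.
- apply: continuous_in_subspaceT => y; rewrite inE/= in_itv/= opprK => yx.
  apply: cvgM; first exact: cvg_cst.
  apply: (@continuous_comp _ _ _ (@GRing.opp R) (fun y => y `^ (- alpha - 1))).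
    exact: oppr_continuous.
  by apply: continuous_powR_gt0; rewrite (lt_le_trans x0)// lerN2.
- by move=> y _; rewrite /G !mulr_ge0 ?powR_ge0// ltW.
Qed.

(** The complementary half-line lies where the density vanishes, so that the
    total mass of the density does not have to be computed. *)
Lemma dist_fun_pareto1 x : - c <= x -> dist_fun mu x = 1.
Proof.
move=> cx; apply/eqP; rewrite eq_le dist_fun_le1/= -lee_fin -dist_funE.
rewrite -(setCK `]-oo, x]%classic) setCitvl probability_setC; last exact: measurable_itv.
rewrite mu_density; last exact: measurable_itv.
rewrite integral0_eq ?sube0// => y.
rewrite /= in_itv/= andbT => xy.
by rewrite /neg_pareto_pdf ltNge (ltW (le_lt_trans cx xy)).
Qed.

Lemma quantile_pareto u : 0 < u < 1 ->
  quantile (dist_fun mu) u = - c * u `^ (- alpha^-1).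
Proof.
move=> u01; have /andP[u0 u1] := u01.
have q x : (quantile (dist_fun mu) u <= x) = (- c * u `^ (- alpha^-1) <= x).
  rewrite dist_fun_quantile_le//; have [cx|xc] := leP (- c) x.
    rewrite dist_fun_pareto1// (ltW u1) mulNr; apply/esym.
    rewrite (le_trans _ cx)// lerN2 ler_peMr ?(ltW c0)// powRN invf_ge1 ?powR_gt0//.
    by rewrite -(powRr0 u) ger_powR ?u0 ?ltW// invr_gt0.
  rewrite dist_fun_pareto//.
  have x0 : 0 < - x by rewrite oppr_gt0 (lt_trans xc)// oppr_lt0.
  have w0 : 0 <= c / - x by rewrite ltW// divr_gt0.
  have eu : u = (u `^ (alpha^-1)) `^ alpha.
    by rewrite -powRrM mulVf ?gt_eqF// powRr1 ?ltW.
  have v0 : 0 < u `^ (alpha^-1) by rewrite powR_gt0.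
  rewrite [X in X <= _]eu; apply/idP/idP.
    move=> h; rewrite leNgt; apply/negP => h'; move: h; rewrite leNgt => /negP; apply.
    rewrite gt0_ltr_powR ?nnegrE ?ltW ?divr_gt0// ltr_pdivrMr//.
    by move: h'; rewrite powRN mulNr ltrNr ltr_pdivrMr// mulrC.
  move=> h; rewrite ge0_ler_powR ?nnegrE ?(ltW v0) ?(ltW alpha0)// ler_pdivlMr//.
  by move: h; rewrite powRN mulNr lerNl ler_pdivlMr// mulrC.
by apply/eqP; rewrite eq_le q lexx/= -q.
Qed.

Lemma dist_fun_quantile_pareto u : 0 < u < 1 ->
  dist_fun mu (quantile (dist_fun mu) u) = u.
Proof.
move=> u01; have /andP[u0 u1] := u01.
rewrite quantile_pareto// dist_fun_pareto.
  rewrite -mulNr opprK invfM mulrA divff ?gt_eqF// mul1r powRN invrK -powRrM.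
  by rewrite mulVf ?gt_eqF// powRr1 ?ltW.
rewrite mulNr ltrN2 ltr_pMr// powRN invf_gt1 ?powR_gt0//.
have <- : 1 `^ alpha^-1 = 1 :> R by rewrite powR1.
by rewrite gt0_ltr_powR ?nnegrE ?invr_gt0// ltW.
Qed.

End pareto.

(** * Chebyshev's inequality for pairwise independent events *)

Section pairwise_independent_events.
Context {d : measure_display} {T : measurableType d} {R : realType}.
Variable P : probability T R.
Variables (A : nat -> set T) (v : R).
Hypothesis mA : forall i, measurable (A i).
Hypothesis PA : forall i, P (A i) = v%:E.
Hypothesis PAA : forall i j, i != j -> P (A i `&` A j) = (v ^+ 2)%:E.

Let S n w : R := \sum_(i < n) \1_(A i) w.

Let mS n : measurable_fun [set: T] (S n).
Proof. by apply: measurable_sum => i; exact: measurable_indic. Qed.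

Let S0 n w : 0 <= S n w.
Proof. by apply: sumr_ge0 => i _; rewrite indicE. Qed.

Lemma integral_count n : (\int[P]_w (S n w)%:E = (n%:R * v)%:E)%E.
Proof.
under eq_integral do rewrite /S -sumEFin.
rewrite ge0_integral_sum//=; last first.
  by move=> i; apply/measurable_EFinP; exact: measurable_indic.
transitivity (\sum_(i < n) v%:E)%E.
  by apply: eq_bigr => i _; rewrite integral_indic// setIT; exact: PA.
by rewrite sumEFin sumr_const card_ord mulr_natl.
Qed.

Lemma integral_sqr_count n :
  (\int[P]_w ((S n w) ^+ 2)%:E =
   (n%:R * v + (n%:R ^+ 2 - n%:R) * v ^+ 2)%:E)%E.
Proof.
have e w : ((S n w) ^+ 2)%:E =
    (\sum_(i < n) \sum_(j < n) (\1_(A i `&` A j) w)%:E)%E :> \bar R.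
  rewrite expr2 /S big_distrl/= -sumEFin; apply: eq_bigr => i _.
  rewrite big_distrr/= -sumEFin; apply: eq_bigr => j _.
  by rewrite indicI.
under eq_integral do rewrite e.
have mI (i j : nat) : measurable_fun [set: T] (fun w => (\1_(A i `&` A j) w : R)%:E).
  by apply/measurable_EFinP; apply: measurable_indic; exact: measurableI.
rewrite ge0_integral_sum//=; last 2 first.
- by move=> i; apply: emeasurable_sum => j.
- by move=> i x _; apply: sume_ge0 => j _; rewrite lee_fin indicE.
transitivity (\sum_(i < n) \sum_(j < n) (if i == j then v else v ^+ 2)%:E)%E.
  apply: eq_bigr => i _; rewrite ge0_integral_sum//=.
  apply: eq_bigr => j _; rewrite integral_indic ?setIT//; last exact: measurableI.
  by have [->|ij] := eqVneq i j; [rewrite setIid; exact: PA|exact: PAA].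
transitivity (\sum_(i < n) (v + (n%:R - 1) * v ^+ 2)%:E)%E.
  apply: eq_bigr => i _; rewrite sumEFin; congr (_%:E).
  rewrite (bigD1 i)//= eqxx; congr (_ + _).
  rewrite (eq_bigr (fun=> v ^+ 2)); last by move=> j; rewrite eq_sym => /negbTE ->.
  rewrite sumr_const cardC1 card_ord.
  have [n0|n0] := posnP n; first by case: i => i; rewrite n0.
  by rewrite -[n in RHS](prednK n0) -natr1 addrK mulr_natl.
rewrite sumEFin sumr_const card_ord; congr (_%:E).
rewrite -mulr_natl; ring.
Qed.

(** All the integrands are kept nonnegative: instead of expanding the centered
    square, the cross term is moved to the other side, so that no integrability
    has to be checked. *)
Lemma integral_sqr_count_centered n :
  (\int[P]_w ((S n w - n%:R * v) ^+ 2)%:E = (n%:R * v * (1 - v))%:E)%E.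
Proof.
have v0 : 0 <= v by rewrite -lee_fin -(PA 0).
have nv0 : 0 <= n%:R * v by rewrite mulr_ge0.
have e : (\int[P]_w ((S n w - n%:R * v) ^+ 2)%:E
   + (2 * (n%:R * v))%:E * \int[P]_w (S n w)%:E =
   \int[P]_w ((S n w) ^+ 2)%:E + ((n%:R * v) ^+ 2)%:E)%E.
  rewrite -ge0_integralZl//=; last 3 first.
  - exact/measurable_EFinP.
  - by move=> w _; rewrite lee_fin.
  - by rewrite lee_fin mulr_ge0.
  rewrite -ge0_integralD//=; last 4 first.
  - by move=> w _; rewrite lee_fin sqr_ge0.
  - by apply/measurable_EFinP/measurable_funX/measurable_funB.
  - by move=> w _; rewrite lee_fin !mulr_ge0.
  - by apply/measurable_EFinP/measurable_funM.
  have <- : (\int[P]_w ((n%:R * v) ^+ 2)%:E = ((n%:R * v) ^+ 2)%:E)%E.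
    by rewrite integral_cst// [X in (_ * X)%E]probability_setT mule1.
  rewrite -ge0_integralD//=; last 3 first.
  - by move=> w _; rewrite lee_fin sqr_ge0.
  - by apply/measurable_EFinP/measurable_funX.
  - by move=> w _; rewrite lee_fin sqr_ge0.
  apply: eq_integral => w _; rewrite -!EFinD; congr (_%:E); ring.
rewrite integral_count integral_sqr_count -EFinM in e.
have cancel (x : \bar R) (a b : R) : (x + a%:E = b%:E)%E -> x = (b - a)%:E.
  by case: x => [r| |]//= [] <-; rewrite addrK.
by rewrite (cancel _ _ _ e); congr (_%:E); ring.
Qed.

Lemma chebyshev_count n (r : R) : 0 < r ->
  (P [set w | (r <= `|S n w - n%:R * v|)%R] <=
   (n%:R * v * (1 - v) / r ^+ 2)%:E)%E.
Proof.
move=> r0; set B := [set w | _].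
have mB : measurable B.
  rewrite -[B]setTI; apply: (measurable_fun_le measurableT (@measurable_cst _ _ _ _ _ r)).
  by apply: measurableT_comp => //; exact: measurable_funB.
rewrite EFinM lee_pdivlMr ?exprn_gt0// -integral_sqr_count_centered.
rewrite -[X in P X]setIT -integral_indic// muleC -ge0_integralZl//=; last 2 first.
- by apply/measurable_EFinP/measurable_indic.
- by rewrite lee_fin sqr_ge0.
apply: ge0_le_integral => //=.
- by move=> w _; rewrite lee_fin mulr_ge0 ?sqr_ge0// indicE.
- by apply/measurable_EFinP/measurable_funM => //; exact: measurable_indic.
- by apply/measurable_EFinP/measurable_funX/measurable_funB.
move=> w _; rewrite -EFinM lee_fin indicE; case: (boolP (w \in B)) => [|_].
  rewrite inE /B/= mulr1 => rw.
  by rewrite -[leRHS]real_normK ?num_real// ler_sqr ?nnegrE ?(ltW r0).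
by rewrite mulr0 sqr_ge0.
Qed.

End pairwise_independent_events.

(** * Empirical quantiles *)

Lemma measurable_fun_sublevel {d} {T : measurableType d} {R : realType}
    (f : T -> R) :
  (forall y, measurable [set t | f t <= y]) -> measurable_fun [set: T] f.
Proof.
move=> mf; apply: (measurability _ (RGenOInfty.measurableE R)) => //.
move=> _ [_ [y ->] <-]; rewrite setTI -setCitvl -preimage_setC.
apply: measurableC; rewrite (_ : _ @^-1` _ = [set t | f t <= y]); first exact: mf.
by apply/seteqP; split => t; rewrite /= in_itv.
Qed.

Lemma measurable_superlevel {d} {T : measurableType d} {R : realType}
    (f : T -> R) (y : R) :
  measurable_fun [set: T] f -> measurable [set t | y < f t].
Proof.
move=> mf; have := mf measurableT _ (measurable_itv `]y, +oo[).
rewrite setTI; congr measurable.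
by apply/seteqP; split => t; rewrite /= in_itv/= andbT.
Qed.

Section empirical.
Context {R : realType}.
Implicit Types (x : nat -> R) (n : nat) (y u : R).

Lemma empirical_quantile_le x n u y : (0 < n)%N -> 0 < u <= 1 ->
  (quantile (empirical_dist_fun x n) u <= y) = (u <= empirical_dist_fun x n y).
Proof.
move=> n0 /andP[u0 u1]; apply: quantile_leP.
- move=> a b ab; rewrite /empirical_dist_fun ler_wpM2l ?invr_ge0//.
  apply: ler_sum => i _; rewrite ler_nat.
  by have [h|h] := leP (x i) a; rewrite ?(le_trans h ab).
- move=> z Fz.
  have h : \forall e \near (0:R)^'+, forall i : 'I_n, (x i <= z + e) = (x i <= z).
    apply: filter_forall => i; have [xz|zx] := leP (x i) z; near=> e.
      by rewrite (le_trans xz)// lerDl.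
    apply/negbTE; rewrite -ltNge -ltrBrDl; near: e; apply: nbhs_right_lt.
    by rewrite subr_gt0.
  near (0:R)^'+ => e; exists e => //; rewrite /empirical_dist_fun.
  rewrite (eq_bigr (fun i : 'I_n => (x i <= z)%R%:R))// => i _; congr (_%:R).
  by congr nat_of_bool; move: i; near: e.
- have h : \forall z \near -oo, forall i : 'I_n, z < x i.
    by apply: filter_forall => i; apply: nbhs_ninfty_lt; exact: num_real.
  near (-oo : set_system R) => z; exists z.
  rewrite /empirical_dist_fun big1 ?mulr0// => i _.
  by rewrite leNgt (_ : z < x i)//; move: i; near: z.
- have h : \forall z \near +oo, forall i : 'I_n, x i <= z.
    by apply: filter_forall => i; apply: nbhs_pinfty_ge; exact: num_real.
  near (+oo : set_system R) => z; exists z.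
  rewrite /empirical_dist_fun (eq_bigr (fun=> 1)); last first.
    by move=> i _; rewrite (_ : x i <= z)//; move: i; near: z.
  by rewrite sumr_const card_ord mulVf// pnatr_eq0 -lt0n.
Unshelve. all: by end_near. Qed.

End empirical.

Section sample.
Context {R : realType} {d : measure_display} {Omega : measurableType d}.
Variables (P : probability Omega R) (X : nat -> {RV P >-> R}).

Lemma measurable_empirical_dist_fun n y :
  measurable_fun [set: Omega] (fun w => empirical_dist_fun (X ^~ w) n y).
Proof.
apply: measurable_funM => //; apply: measurable_sum => i.
rewrite (_ : (fun _ => _) = (\1_(X i @^-1` `]-oo, y]) : Omega -> R)); last first.
  apply/funext => w; rewrite indicE; congr (_%:R).
  by congr nat_of_bool; apply/idP/idP; rewrite inE/= in_itv.
apply: measurable_indic; rewrite -[X in measurable X]setTI.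
exact: measurable_funPT.
Qed.

(** Joint measurability in the sample and the level, as needed for Tonelli's
    theorem: a sublevel set of the quantile is described by the empirical
    distribution function. *)
Lemma measurable_empirical_quantile n : (0 < n)%N ->
  measurable_fun [set: Omega * R] (fun z : Omega * R =>
    if 0 < z.2 < 1 then quantile (empirical_dist_fun (X ^~ z.1) n) z.2 else 0).
Proof.
move=> n0; apply: measurable_fun_sublevel => y.
pose Z : set (Omega * R) := [set z | 0 < z.2 < 1].
have mZ : measurable Z.
  rewrite [Z](_ : _ = [set: Omega] `*` `]0, 1[%classic); first exact: measurableX.
  by apply/seteqP; split => z; rewrite /Z /= in_itv/=; tauto.
rewrite (_ : mkset _ = (Z `&` [set z | z.2 <= empirical_dist_fun (X ^~ z.1) n y])
  `|` (~` Z `&` [set z | 0 <= y])).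
  apply: measurableU.
    rewrite -[X in _ `&` X]setTI; apply: measurableI => //.
    apply: measurable_fun_le => //.
    apply: (@measurableT_comp _ _ _ _ _ _ (fun w => empirical_dist_fun (X ^~ w) n y)) => //.
    exact: measurable_empirical_dist_fun.
  apply: measurableI; first exact: measurableC.
  have [y0|y0] := leP 0 y.
    by rewrite (_ : mkset _ = setT)//; apply/seteqP.
  by rewrite (_ : mkset _ = set0)//; apply/seteqP; split.
apply/seteqP; split => -[w u]; rewrite /Z /=; case: ifPn => [u01|u01].
- rewrite empirical_quantile_le//; first by left.
  by have /andP[-> /ltW] := u01.
- by right; split => //; exact/negP.
- case => [[_ h]|[]//]; rewrite empirical_quantile_le//.
  by have /andP[-> /ltW] := u01.
- by case => [[]|[]]//; move/negP: u01.
Qed.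

End sample.

(** * Deviation of the empirical quantiles *)

(** Equivalent to [1 + a t / (1 + t) <= (1 + t)^a], which follows from
    [expR x >= 1 + x] and [ln (1 + t) >= t / (1 + t)]. *)
Lemma powR1D_increment {R : realType} (a t : R) : 0 < a -> 0 <= t ->
  a * t <= (1 + t + a * t) * (1 - (1 + t) `^ (- a)).
Proof.
move=> a0 t0; have t1 : 0 < 1 + t by rewrite ltr_wpDr.
have p0 : 0 < (1 + t) `^ a by rewrite powR_gt0.
have lnt : t / (1 + t) <= ln (1 + t).
  have := @le_ln1Dx _ ((1 + t)^-1 - 1); rewrite addrCA subrr addr0 => /(_ _).
  rewrite lnV ?posrE// => h; rewrite -lerN2; apply: le_trans (h _) _.
    by rewrite ltrBrDl subrr invr_gt0.
  by rewrite le_eqVlt; apply/orP; left; apply/eqP; field; rewrite gt_eqF.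
have ep : 1 + a * (t / (1 + t)) <= (1 + t) `^ a.
  rewrite /powR gt_eqF// (le_trans _ (expR_ge1Dx _))// lerD2l.
  by rewrite ler_pM2l.
have h : 1 + t + a * t <= (1 + t) * (1 + t) `^ a.
  rewrite -ler_pdivrMl//; apply: le_trans ep.
  by rewrite le_eqVlt; apply/orP; left; apply/eqP; field; rewrite gt_eqF.
rewrite powRN mulrBr mulr1 lerBrDr -lerBrDl addrK.
by rewrite ler_pdivrMr.
Qed.

(** The constant in the lower bound [pareto_increment] for the growth of the
    Pareto distribution function over a step of length at most 1. *)
Definition pareto_rate {R : realType} (alpha c : R) : R := alpha / (c + 1 + alpha).

Section tail.
Context {R : realType}.
Variables (alpha c : R) (alpha0 : 0 < alpha) (c0 : 0 < c).
Variable mu : probability R R.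
Hypothesis mu_density : forall A : set R, measurable A ->
  mu A = (\int[lebesgue_measure]_(x in A) (neg_pareto_pdf alpha c x)%:E)%E.

Let F := dist_fun mu.

Let K := pareto_rate alpha c.

Let K0 : 0 < K.
Proof. by rewrite divr_gt0// !addr_gt0. Qed.

Let FE y : c < y -> F (- y) = (c / y) `^ alpha.
Proof.
by move=> cy; rewrite /F (dist_fun_pareto alpha0 c0 mu_density) ?ltrN2// opprK.
Qed.

(** In terms of [v = F (- y) = (c / y)^alpha], the density at [- y] is a multiple
    of [v^(1 + 1 / alpha)]; over a step of length at most 1 the density changes
    at most by a constant factor, because [y > c]. *)
Lemma pareto_increment y s : c < y -> 0 < s <= 1 ->
  K * s * F (- y) `^ (1 + alpha^-1) <= F (- y) - F (- (y + s)).
Proof.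
move=> cy /andP[s0 s1].
have y0 : 0 < y by exact: lt_trans cy.
have cy0 : 0 < c / y by rewrite divr_gt0.
have cys : c < y + s by rewrite (lt_trans cy)// ltrDl.
rewrite !FE//.
set t := s / y.
have t0 : 0 <= t by rewrite ltW// divr_gt0.
have t1 : 0 < 1 + t by rewrite ltr_wpDr.
have -> : c / (y + s) = (c / y) * (1 + t)^-1.
  by rewrite /t; field; rewrite !gt_eqF// addr_gt0.
rewrite [X in _ - X]powRM ?invr_ge0 ?(ltW cy0) ?(ltW t1)//.
rewrite -(powR_inv1 (ltW t1)) -!powRrM mulN1r.
rewrite mulrDr mulr1 mulfV ?gt_eqF// powRD; last by rewrite (gt_eqF cy0) implybT.
rewrite powRr1 ?(ltW cy0)// -[X in _ <= X - _]mulr1 -mulrBr.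
rewrite mulrCA ler_pM2l ?powR_gt0//.
have h := powR1D_increment alpha0 t0.
set q := 1 - _ in h *.
have q0 : 0 <= q.
  rewrite -(pmulr_rge0 _ (_ : 0 < 1 + t + alpha * t)); last first.
    by rewrite ltr_wpDr// mulr_ge0// ltW.
  by rewrite (le_trans _ h)// mulr_ge0// ltW.
have -> : K * s * (c / y) = alpha * t / ((c + 1 + alpha) / c).
  by rewrite /K /pareto_rate /t; field; rewrite !gt_eqF// !addr_gt0.
rewrite ler_pdivrMr ?divr_gt0 ?addr_gt0//.
apply: le_trans h _; rewrite mulrC ler_wpM2l//.
have tc : t <= c^-1.
  by rewrite /t ler_pdivrMr// ler_pdivlMl// (le_trans _ (ltW cy))// ler_piMr// ltW.
have -> : (c + 1 + alpha) / c = 1 + c^-1 + alpha * c^-1.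
  by field; rewrite gt_eqF.
by rewrite lerD ?lerD2l// ler_pM2l.
Qed.

Context {d : measure_display} {Omega : measurableType d}.
Variables (P : probability Omega R) (X : nat -> {RV P >-> R}).
Hypothesis X_indep : mutually_independent P (fun (i : nat) (w : Omega) => X i w).
Hypothesis X_law : forall (i : nat) (A : set R), measurable A ->
  distribution P (X i) A = mu A.

Lemma empirical_deviation n y r : (0 < n)%N -> 0 < r ->
  (P [set w | (r <= `|empirical_dist_fun (X ^~ w) n y - F y|)%R] <=
   (F y * (1 - F y) / (n%:R * r ^+ 2))%:E)%E.
Proof.
move=> n0 r0; have nR : 0 < n%:R :> R by rewrite ltr0n.
pose A i := X i @^-1` `]-oo, y].
have mA i : measurable (A i).
  by rewrite -[X in measurable X]setTI; exact: measurable_funPT.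
have PA i : P (A i) = (F y)%:E by rewrite -dist_funE -(X_law i).
have PAA i j : i != j -> P (A i `&` A j) = (F y ^+ 2)%:E.
  move=> ij; have := X_indep (s := [:: i; j]) (A := fun=> `]-oo, y]%classic).
  rewrite /= inE ij big_cons big_seq1 !PA -EFinM -expr2 => <-//.
  congr (P _); apply/seteqP; split => w /=.
    by move=> [Ai Aj] k /=; rewrite !inE => /orP[]/eqP ->.
  by move=> h; split; apply: h; rewrite /= !inE eqxx ?orbT.
have empE w : `|empirical_dist_fun (X ^~ w) n y - F y| =
    n%:R^-1 * `|\sum_(i < n) \1_(A i) w - n%:R * F y|.
  rewrite -[n%:R^-1 in RHS]gtr0_norm ?invr_gt0// -normrM mulrBr mulKf ?gt_eqF//.
  congr (`|_ * _ - _|); apply: eq_bigr => i _; rewrite indicE.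
  by congr (nat_of_bool _)%:R; apply/idP/idP; rewrite inE /A/= in_itv.
have := chebyshev_count mA PA PAA n (mulr_gt0 nR r0).
rewrite (_ : [set w | _] = [set w |
    r <= `|empirical_dist_fun (X ^~ w) n y - F y|]).
  move=> /le_trans; apply; rewrite lee_fin le_eqVlt; apply/orP; left.
  by apply/eqP; field; rewrite !gt_eqF.
by apply/seteqP; split => w /=; rewrite empE ler_pdivlMl.
Qed.

Let measurable_deviation n y r :
  measurable [set w | r <= `|empirical_dist_fun (X ^~ w) n y - F y|].
Proof.
rewrite -[X in measurable X]setTI.
apply: (measurable_fun_le measurableT (@measurable_cst _ _ _ _ _ r)).
apply: measurableT_comp => //; apply: measurable_funB => //.
exact: measurable_empirical_dist_fun.
Qed.

Lemma measurable_quantile_dev n u : (0 < n)%N -> 0 < u < 1 ->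
  measurable_fun [set: Omega] (fun w =>
    `|quantile (empirical_dist_fun (X ^~ w) n) u - quantile F u|).
Proof.
move=> n0 u01; apply: measurableT_comp => //; apply: measurable_funB => //.
have := measurableT_comp (measurable_empirical_quantile X n0)
  (pair2_measurable u : measurable_fun [set: Omega] _).
by rewrite /comp/= u01.
Qed.

(** The Chebyshev bound for a deviation of size [K s z^(1 + 1 / alpha)], when the
    probability of the event is at most [z]. *)
Lemma bernoulli_variance_le v z s : 0 <= v -> v <= z -> 0 < z -> 0 < s ->
  v * (1 - v) / (K * s * z `^ (1 + alpha^-1)) ^+ 2 <=
  (K ^- 2 / s ^+ 2) * z `^ (- (1 + 2 / alpha)).
Proof.
move=> v0 vz z0 s0.
have zp p : 0 < z `^ p by rewrite powR_gt0.
have -> : z `^ (- (1 + 2 / alpha)) = z / (z `^ (1 + alpha^-1)) ^+ 2.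
  rewrite -powR_mulrn ?ltW// -powRrM -powRN.
  have -> q : z * z `^ q = z `^ (1 + q).
    by rewrite powRD ?powRr1 ?(ltW z0)// (gt_eqF z0) implybT.
  by congr (_ `^ _); ring.
have -> : K ^- 2 / s ^+ 2 * (z / (z `^ (1 + alpha^-1)) ^+ 2) =
   z / (K * s * z `^ (1 + alpha^-1)) ^+ 2.
  by field; rewrite !gt_eqF.
have Ksz : 0 < K * s * z `^ (1 + alpha^-1) by exact: mulr_gt0 (mulr_gt0 K0 s0) _.
rewrite ler_pM2r ?invr_gt0 ?exprn_gt0//.
by rewrite (le_trans _ vz)// ler_piMr// gerBl.
Qed.

(** The quantile is too large by [s] only if the empirical distribution function
    is too small at [x + s], and too small by [s] only if it is too large at
    [x - s]; Chebyshev's inequality applies to both events. *)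
Lemma quantile_deviation n u s : (0 < n)%N -> 0 < u < 1 -> 0 < s <= 1 ->
  (P [set w | (s < `|quantile (empirical_dist_fun (X ^~ w) n) u - quantile F u|)%R] <=
   (2 * K ^- 2 / (n%:R * s ^+ 2) * u `^ (- (1 + 2 / alpha)))%:E)%E.
Proof.
move=> n0 u01 /andP[s0 s1]; have /andP[u0 u1] := u01.
have u01' : 0 < u <= 1 by rewrite u0 ltW.
have nR : 0 < n%:R :> R by rewrite ltr0n.
set x := quantile F u.
have Fx : F x = u by exact: (dist_fun_quantile_pareto alpha0 c0 mu_density).
have xc : x < - c.
  rewrite ltNge; apply/negP => /(dist_fun_pareto1 mu_density).
  by rewrite -/F Fx => ue; move: u1; rewrite ue ltxx.
set bnd := K ^- 2 / s ^+ 2 * u `^ (- (1 + 2 / alpha)) / n%:R.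
have bnd0 : 0 <= bnd.
  by rewrite !mulr_ge0 ?invr_ge0 ?powR_ge0// exprn_ge0// ltW.
have -> : 2 * K ^- 2 / (n%:R * s ^+ 2) * u `^ (- (1 + 2 / alpha)) = bnd + bnd.
  by rewrite /bnd; field; rewrite !gt_eqF.
have mQ y : measurable [set w | quantile (empirical_dist_fun (X ^~ w) n) u <= y].
  rewrite (_ : mkset _ = [set w | u <= empirical_dist_fun (X ^~ w) n y]).
    rewrite -[X in measurable X]setTI.
    apply: (measurable_fun_le measurableT (@measurable_cst _ _ _ _ _ u)).
    exact: measurable_empirical_dist_fun.
  by apply/seteqP; split => w /=; rewrite empirical_quantile_le.
pose U := ~` [set w | quantile (empirical_dist_fun (X ^~ w) n) u <= x + s].
pose L := [set w | quantile (empirical_dist_fun (X ^~ w) n) u <= x - s].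
have mU : measurable U by exact: measurableC.
have mL : measurable L by exact: mQ.
apply: (@le_trans _ _ (P (U `|` L))).
  apply: le_measure; rewrite ?inE; last 2 first.
  - exact: measurableU.
  - move=> w /=; rewrite -/x => h.
    have [h1|h1] := leP (quantile (empirical_dist_fun (X ^~ w) n) u) x.
      right; rewrite /L/=.
      move: h; rewrite ler0_norm ?subr_le0// opprB ltrBrDr => h.
      by rewrite lerBrDr addrC ltW.
    left; rewrite /U/= => h2; move: h; rewrite gtr0_norm ?subr_gt0//.
    by rewrite ltrBrDr ltNge addrC h2.
  by apply: measurable_superlevel; exact: measurable_quantile_dev.
apply: (le_trans (measureU2 _ mU mL)); rewrite EFinD; apply: leeD.
- have [cxs|xsc] := leP (- c) (x + s).
    (* To the right of [- c] the variance is 0 and the event is null. *)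
    have Fxs : F (x + s) = 1 by exact: (dist_fun_pareto1 mu_density).
    apply: (@le_trans _ _ 0%E); last by rewrite lee_fin.
    have := empirical_deviation (x + s) n0 (_ : 0 < 1 - u).
    rewrite subr_gt0 Fxs subrr mulr0 mul0r => /(_ u1); apply: le_trans.
    apply: le_measure; rewrite ?inE//.
      by have := measurable_deviation n (x + s) (1 - u); rewrite Fxs.
    move=> w /negP; rewrite empirical_quantile_le// -ltNge => h.
    by rewrite /= distrC (le_trans _ (ler_norm _))// lerD2l lerN2 ltW.
  set v := F (x + s).
  have cxs : c < - (x + s) by rewrite ltrNr.
  have s01 : 0 < s <= 1 by rewrite s0.
  have := pareto_increment cxs s01.
  have -> : - (- (x + s) + s) = x by ring.
  rewrite opprK Fx -/v => h.
  have uv : u <= v by rewrite -Fx; apply: dist_fun_homo; rewrite lerDl ltW.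
  have v0 : 0 < v by exact: lt_le_trans uv.
  have r0 : 0 < K * s * v `^ (1 + alpha^-1) by apply: mulr_gt0; [exact: mulr_gt0|rewrite powR_gt0].
  apply: (@le_trans _ _ (P [set w | (K * s * v `^ (1 + alpha^-1) <=
     `|empirical_dist_fun (X ^~ w) n (x + s) - v|)%R])).
    apply: le_measure; rewrite ?inE//.
    move=> w /negP; rewrite empirical_quantile_le// -ltNge => h'.
    rewrite /= distrC (le_trans _ (ler_norm _))// (le_trans h)//.
    by rewrite lerD2l lerN2 ltW.
  apply: (le_trans (empirical_deviation _ n0 r0)).
  rewrite -/v lee_fin invfM mulrCA mulrC /bnd ler_pM2r ?invr_gt0//.
  apply: (le_trans (bernoulli_variance_le (ltW v0) (lexx _) v0 s0)).
  rewrite ler_wpM2l ?divr_ge0 ?invr_ge0 ?exprn_ge0 ?(ltW K0) ?(ltW s0)//.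
  rewrite !powRN lef_pV2 ?posrE ?powR_gt0// ge0_ler_powR ?nnegrE ?(ltW u0) ?(ltW v0)//.
  by rewrite addr_ge0// divr_ge0// ltW.
- set v := F (x - s).
  have s01 : 0 < s <= 1 by rewrite s0.
  have cx : c < - x by rewrite ltrNr.
  have := pareto_increment cx s01.
  have -> : - (- x + s) = x - s by ring.
  rewrite opprK Fx -/v => h.
  have vu : v <= u by rewrite -Fx; apply: dist_fun_homo; rewrite gerBl ltW.
  have v0 : 0 <= v by exact: dist_fun_ge0.
  have r0 : 0 < K * s * u `^ (1 + alpha^-1) by apply: mulr_gt0; [exact: mulr_gt0|rewrite powR_gt0].
  apply: (@le_trans _ _ (P [set w | (K * s * u `^ (1 + alpha^-1) <=
     `|empirical_dist_fun (X ^~ w) n (x - s) - v|)%R])).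
    apply: le_measure; rewrite ?inE//.
    move=> w; rewrite /L/= empirical_quantile_le// => h'.
    by rewrite (le_trans _ (ler_norm _))// (le_trans h)// lerD2r.
  apply: (le_trans (empirical_deviation _ n0 r0)).
  rewrite -/v lee_fin invfM mulrCA mulrC /bnd ler_pM2r ?invr_gt0//.
  exact: bernoulli_variance_le.
Qed.

End tail.

(** * Means from weak tail bounds *)

Section powR_integral.
Context {R : realType}.

Lemma integral_powRN_lty (p : R) : p < 1 ->
  (\int[lebesgue_measure]_(x in `]0%R, 1%R[) (x `^ (- p))%:E < +oo)%E.
Proof.
move=> p1; have q0 : 0 < 1 - p by rewrite subr_gt0.
pose F (x : R) : R := (1 - p)^-1 * x `^ (1 - p).
have dF (x : R) : 0 < x -> is_derive x 1 F (x `^ (- p)).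
  move=> x0.
  have d1 : is_derive x 1 (fun y : R => y `^ (1 - p)) ((1 - p) * x `^ (1 - p - 1)).
    apply: DeriveDef; first by apply: derivable_powR; rewrite in_itv/= x0.
    by rewrite -derive1E powR_derive1// in_itv/= x0.
  apply: is_derive_eq; rewrite /GRing.scale/= mulrA mulVf ?gt_eqF// mul1r.
  by congr (_ `^ _); ring.
have int_le (a : R) : 0 < a -> a < 1 ->
    (\int[lebesgue_measure]_(x in `[a, 1%R]) (x `^ (- p))%:E <= ((1 - p)^-1)%:E)%E.
  move=> a0 a1; rewrite (@continuous_FTC2 _ _ F)//.
  - by rewrite -EFinB lee_fin /F powR1 mulr1 gerBl mulr_ge0 ?invr_ge0 ?powR_ge0 ?ltW.
  - apply: continuous_in_subspaceT => x; rewrite inE/= in_itv/= => /andP[ax _].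
    by apply: continuous_powR_gt0; exact: lt_le_trans ax.
  - split.
    + by move=> x; rewrite in_itv/= => /andP[ax _]; have [] := dF _ (lt_trans a0 ax).
    + apply: cvg_at_right_filter; apply: cvgM; first exact: cvg_cst.
      exact: continuous_powR_gt0.
    + apply: cvg_at_left_filter; apply: cvgM; first exact: cvg_cst.
      exact: continuous_powR_gt0.
  - move=> x; rewrite in_itv/= => /andP[ax _].
    by rewrite derive1E; have [_] := dF _ (lt_trans a0 ax).
have mf D : measurable_fun D (fun x : R => (x `^ (- p))%:E).
  by apply/measurable_EFinP; apply: measurable_funTS.
have f0 (x : R) : (0 <= (x `^ (- p))%:E)%E by rewrite lee_fin powR_ge0.
(* [i.+2] makes the left end point smaller than 1 for every [i]. *)
pose G (i : nat) := `[(i.+2%:R)^-1 : R, 1]%classic.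
have cG := @ge0_nondecreasing_set_cvg_integral _ (measurableTypeR R) R G
  (fun x : R => (x `^ (- p))%:E) lebesgue_measure.
apply: (@le_lt_trans _ _ ((1 - p)^-1)%:E); last exact: ltry.
apply: (@le_trans _ _ (\int[lebesgue_measure]_(x in \bigcup_i G i) (x `^ (- p))%:E)%E).
  apply: ge0_subset_integral => //.
    by apply: bigcup_measurable => i _; exact: measurable_itv.
    exact: mf.
  move=> x /=; rewrite in_itv/= => /andP[x0 x1].
  exists (Num.truncn x^-1) => //; rewrite /G/= in_itv/= (ltW x1) andbT.
  rewrite -[leRHS]invrK lef_pV2 ?posrE ?invr_gt0//.
  rewrite (le_trans (ltW (truncnS_gt _)))// ler_nat//.
have cvgG : (\int[lebesgue_measure]_(x in G i) (x `^ (- p))%:E)%E @[i --> \oo] -->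
    (\int[lebesgue_measure]_(x in \bigcup_i G i) (x `^ (- p))%:E)%E.
  apply: cG => //.
    move=> i j ij; apply/subsetPset; apply: subset_itvr.
    by rewrite bnd_simp lef_pV2 ?posrE// ler_nat !ltnS.
    by move=> i; exact: measurable_itv.
  by move=> i; exact: mf.
rewrite -(cvg_lim _ cvgG)//; apply: lime_le; first exact: cvgP cvgG.
by apply: nearW => i; apply: int_le => //; rewrite invf_lt1// ltr1n.
Qed.

(** A probability is at most 1, so that a tail bounded by [A / r] is also bounded
    by [(A / r)^theta], which unlike [A / r] is integrable near 0 since
    [theta < 1]. *)
Lemma expectation_weak_tail {d} {T : measurableType d} (P : probability T R)
    (Z : T -> R) (A theta : R) :
  measurable_fun [set: T] Z -> 0 <= A -> 0 <= theta < 1 ->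
  (forall w, 0 <= Z w <= 1) ->
  (forall r, 0 < r < 1 -> (P [set w | (r < Z w)%R] <= (A / r)%:E)%E) ->
  (\int[P]_w (Z w)%:E <=
   (A `^ theta)%:E * \int[lebesgue_measure]_(r in `]0%R, 1%R[) (r `^ (- theta))%:E)%E.
Proof.
move=> mZ A0 /andP[t0 t1] Z01 tail.
pose Y := RV_of P mZ.
have Y0 w : 0 <= Y w by have /andP[] := Z01 w.
have ccdfE r : ccdf Y r = P [set w | (r < Z w)%R].
  rewrite /ccdf /distribution /pushforward; congr (P _).
  by apply/seteqP; split => w; rewrite /= in_itv/= andbT.
have -> : (\int[P]_w (Z w)%:E)%E = ('E_P[Y])%E by rewrite unlock.
rewrite ge0_expectation_ccdf// -integral_itv_obnd_cbnd; last first.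
  by apply: measurable_funTS; exact: ccdf_measurable.
have -> : (`]0, +oo[ = `]0, 1[ `|` `[1, +oo[ :> set R)%classic.
  apply/seteqP; split => x /=; rewrite !in_itv/= ?andbT.
    by move=> x0; rewrite x0/=; have [] := ltP x 1; [left|right].
  by case => [/andP[]//|]; exact: lt_le_trans.
rewrite ge0_integral_setU//; last 2 first.
- by apply: measurable_funTS; exact: ccdf_measurable.
- rewrite disj_set2E; apply/eqP/seteqP; split => // x [] /=; rewrite !in_itv/= andbT.
  by move=> /andP[_ x1]; rewrite leNgt x1.
rewrite [X in (_ + X)%E]integral0_eq ?adde0; last first.
  move=> r; rewrite /= in_itv/= andbT => r1; rewrite ccdfE.
  rewrite (_ : mkset _ = set0) ?measure0//; apply/seteqP; split => // w /=.
  by move=> /(le_lt_trans r1); have /andP[_] := Z01 w; rewrite leNgt => /negP.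
have mf : measurable_fun (`]0, 1[%classic : set R) (fun r : R => (r `^ (- theta))%:E).
  by apply/measurable_EFinP; apply: measurable_funTS.
rewrite -ge0_integralZl//; last 2 first.
- by move=> r _; rewrite lee_fin powR_ge0.
- by rewrite lee_fin powR_ge0.
apply: ge0_le_integral => //.
- by apply: measurable_funTS; exact: ccdf_measurable.
- by apply: emeasurable_funM.
move=> r; rewrite /= in_itv/= => r01; have /andP[r0 r1] := r01.
rewrite ccdfE -EFinM.
have -> : A `^ theta * r `^ (- theta) = (A / r) `^ theta.
  rewrite powRM ?invr_ge0 ?(ltW r0)//; congr (_ * _).
  by rewrite -powR_inv1 ?(ltW r0)// -powRrM mulN1r.
have [Ar|Ar] := leP (A / r) 1.
  apply: (le_trans (tail _ r01)); rewrite lee_fin.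
  have : 0 <= A / r by rewrite divr_ge0// ltW.
  rewrite le_eqVlt => /predU1P[<-|Ar0]; first exact: powR_ge0.
  by rewrite ger1_powR ?Ar0// ltW.
rewrite (@le_trans _ _ 1%E)//; last first.
  by rewrite lee_fin -(powRr0 (A / r)) ler_powR// ltW.
by apply: probability_le1; exact: measurable_superlevel.
Qed.

End powR_integral.

(** * Mean of the truncated Wasserstein statistic *)

Section wstar_mean.
Context {R : realType}.
Variables (alpha c : R) (alpha0 : 0 < alpha) (c0 : 0 < c).
Variable mu : probability R R.
Hypothesis mu_density : forall A : set R, measurable A ->
  mu A = (\int[lebesgue_measure]_(x in A) (neg_pareto_pdf alpha c x)%:E)%E.
Context {d : measure_display} {Omega : measurableType d}.
Variables (P : probability Omega R) (X : nat -> {RV P >-> R}).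

(** The extension by 0 outside of the unit interval makes the integrand jointly
    measurable on the whole product. *)
Let h n (z : Omega * R) : R :=
  if 0 < z.2 < 1 then
    (Num.min `|quantile (empirical_dist_fun (X ^~ z.1) n) z.2
               - quantile (dist_fun mu) z.2| 1) ^+ 2
  else 0.

Let h_ge0 n z : 0 <= h n z.
Proof. by rewrite /h; case: ifP => // _; exact: sqr_ge0. Qed.

Let h_le1 n z : h n z <= 1.
Proof.
by rewrite /h; case: ifP.
Qed.

Let measurable_h n : (0 < n)%N -> measurable_fun [set: Omega * R] (h n).
Proof.
move=> n0.
pose q (z : Omega * R) : R := if 0 < z.2 < 1 then
  quantile (empirical_dist_fun (X ^~ z.1) n) z.2 else 0.
rewrite (_ : h n = fun z => if 0 < z.2 < 1 then
  (Num.min `|q z - (- c * z.2 `^ (- alpha^-1))| 1) ^+ 2 else 0); last first.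
  apply/funext => z; rewrite /h /q; case: ifPn => // z01.
  by rewrite (quantile_pareto alpha0 c0 mu_density).
apply: measurable_fun_ifT => //.
  by apply: measurable_and; apply: measurable_fun_ltr.
apply: measurable_funX; apply: measurable_minr => //.
apply: measurableT_comp => //; apply: measurable_funB.
  exact: measurable_empirical_quantile.
apply: measurable_funM => //.
by apply: (@measurableT_comp _ _ _ _ _ _ (@powR R ^~ (- alpha^-1))).
Qed.

Let wstar_h n w : (0 < n)%N -> (wstar mu (X ^~ w) n)%:E =
  (\int[lebesgue_measure]_u (h n (w, u))%:E)%E.
Proof.
move=> n0.
have hE : (\int[lebesgue_measure]_u (h n (w, u))%:E =
   \int[lebesgue_measure]_(u in `]0%R, 1%R[)
     ((Num.min `|quantile (empirical_dist_fun (X ^~ w) n) u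
               - quantile (dist_fun mu) u| 1) ^+ 2)%:E)%E.
  rewrite [RHS]integral_mkcond; apply: eq_integral => u _.
  by rewrite patchE /h mem_setE in_itv/=; case: ifP.
rewrite hE /wstar /Rintegral fineK// -hE ge0_fin_numE; last first.
  by apply: integral_ge0 => u _; rewrite lee_fin.
apply: (@le_lt_trans _ _ (\int[lebesgue_measure]_(u in `]0%R, 1%R[) (cst 1%E) u)%E);
  last first.
  rewrite integral_cst//= mul1e lebesgue_measure_itv/= lte_fin ltr01.
  by rewrite sube0 ltry.
rewrite [leRHS]integral_mkcond; apply: ge0_le_integral => //=.
- by move=> u _; rewrite lee_fin.
- apply/measurable_EFinP.
  exact: (measurableT_comp (measurable_h n0) (pair1_measurable w)).
- by apply: (measurable_restrictT _ _).1 => //; exact: measurable_itv.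
move=> u _; rewrite patchE mem_setE in_itv/=; case: ifPn => [_|u01].
  by rewrite lee_fin.
by rewrite /h/= (negbTE u01).
Qed.

Lemma measurable_wstar n : (0 < n)%N ->
  measurable_fun [set: Omega] (fun w => wstar mu (X ^~ w) n).
Proof.
move=> n0; apply/measurable_EFinP.
rewrite (_ : _ \o _ = fubini_F lebesgue_measure (EFin \o h n)); last first.
  by apply/funext => w /=; rewrite wstar_h.
apply: measurable_fun_fubini_tonelli_F => [|z]; last by rewrite /= lee_fin.
by apply/measurable_EFinP; exact: measurable_h.
Qed.

Hypothesis X_indep : mutually_independent P (fun (i : nat) (w : Omega) => X i w).
Hypothesis X_law : forall (i : nat) (A : set R), measurable A ->
  distribution P (X i) A = mu A.

(** By Tonelli's theorem the mean is the integral over [u] of the mean truncated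
    squared deviation at [u], which is at most
    [(C u^-(1 + 2 / alpha) / n)^theta] times a constant. *)
Lemma mean_wstar_le theta : 0 < theta < alpha / (alpha + 2) ->
  exists2 M : R, 0 <= M & forall n, (0 < n)%N ->
    (\int[P]_w (wstar mu (X ^~ w) n)%:E <= (M * n%:R `^ (- theta))%:E)%E.
Proof.
move=> /andP[t0 tlt].
have a2 : 0 < alpha + 2 by rewrite addr_gt0.
have t1 : theta < 1.
  by rewrite (lt_trans tlt)// ltr_pdivrMr// mul1r ltrDl.
(* The exponent of [u] in the bound is above -1 exactly because
   [theta < alpha / (alpha + 2)]. *)
have p1 : theta * (1 + 2 / alpha) < 1.
  have -> : 1 + 2 / alpha = (alpha + 2) / alpha by field; rewrite gt_eqF.
  by rewrite mulrA ltr_pdivrMr// mul1r -ltr_pdivlMr.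
have int_fin (p : R) : p < 1 -> exists2 I : R, 0 <= I &
    (\int[lebesgue_measure]_(x in `]0%R, 1%R[) (x `^ (- p))%:E)%E = I%:E.
  move=> /integral_powRN_lty; set I := (X in (X < _)%E) => I1.
  have I0 : (0 <= I)%E by apply: integral_ge0 => x _; rewrite lee_fin powR_ge0.
  exists (fine I); first exact: fine_ge0.
  by rewrite fineK// ge0_fin_numE.
have [I I0 IE] := int_fin _ t1; have [J J0 JE] := int_fin _ p1.
have [C C0 CE] : exists2 C : R, 0 <= C & C = 2 * pareto_rate alpha c ^- 2.
  by exists (2 * pareto_rate alpha c ^- 2); rewrite // mulr_ge0// invr_ge0 sqr_ge0.
exists (C `^ theta * J * I); first by rewrite !mulr_ge0 ?powR_ge0.
move=> n n0; have nR : 0 < n%:R :> R by rewrite ltr0n.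
under eq_integral do rewrite wstar_h//.
have mh : measurable_fun [set: Omega * R] (fun z => (h n z)%:E).
  by apply/measurable_EFinP; exact: measurable_h.
have -> : (\int[P]_w \int[lebesgue_measure]_u (h n (w, u))%:E =
           \int[lebesgue_measure]_u \int[P]_w (h n (w, u))%:E)%E.
  apply: (@fubini_tonelli _ _ Omega (measurableTypeR R) R P lebesgue_measure
    (fun z => (h n z)%:E)) => // z.
  by rewrite lee_fin.
pose A (u : R) : R := C * n%:R^-1 * u `^ (- (1 + 2 / alpha)).
have A0 u : 0 <= A u by rewrite !mulr_ge0 ?powR_ge0 ?invr_ge0.
have slice u : 0 < u < 1 ->
    (\int[P]_w (h n (w, u))%:E <= (A u `^ theta * I)%:E)%E.
  move=> u01; rewrite EFinM -IE; apply: expectation_weak_tail => //.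
  - exact: (measurableT_comp (measurable_h n0) (pair2_measurable u)).
  - by rewrite (ltW t0).
  - by move=> w; rewrite h_ge0 h_le1.
  move=> r /andP[r0 r1].
  (* The layer [r] of the squared deviation is the layer [sqrt r] of the
     deviation. *)
  have s0 : 0 < Num.sqrt r by rewrite sqrtr_gt0.
  have s1 : 0 < Num.sqrt r <= 1 by rewrite s0 -sqrtr1 ler_sqrt ?ltW.
  have := quantile_deviation alpha0 c0 mu_density X_indep X_law n0 u01 s1.
  rewrite sqr_sqrtr ?(ltW r0)// => dev.
  rewrite (_ : A u / r = 2 * pareto_rate alpha c ^- 2 / (n%:R * r) *
     u `^ (- (1 + 2 / alpha))); last first.
    have K0 : 0 < pareto_rate alpha c by rewrite divr_gt0// !addr_gt0.
    by rewrite /A CE; field; rewrite !gt_eqF.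
  apply: le_trans dev; apply: le_measure; rewrite ?inE.
  - apply: measurable_superlevel.
    exact: (measurableT_comp (measurable_h n0) (pair2_measurable u)).
  - by apply: measurable_superlevel; exact: (measurable_quantile_dev _ X n0 u01).
  move=> w /=; rewrite /h u01/= => rh.
  set D := `|_ - _| in rh *.
  have m0 : 0 <= Num.min D 1 by rewrite le_min normr_ge0 ler01.
  rewrite (@lt_le_trans _ _ (Num.min D 1))// ?ge_min ?lexx//.
  by rewrite -ltr_sqr ?nnegrE ?sqrtr_ge0// sqr_sqrtr ?(ltW r0).
apply: (@le_trans _ _ (\int[lebesgue_measure]_(u in `]0%R, 1%R[)
   (((C / n%:R) `^ theta * I)%:E * (u `^ (- (theta * (1 + 2 / alpha))))%:E))%E).
  rewrite [leRHS]integral_mkcond; apply: ge0_le_integral => //=.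
  - by move=> u _; apply: integral_ge0 => w _; rewrite lee_fin.
  - apply: (@measurable_fun_fubini_tonelli_G _ _ Omega (measurableTypeR R) R P
      (fun z => (h n z)%:E)) => // z.
    by rewrite lee_fin.
  - apply: (measurable_restrictT _ _).1 => //.
    by apply: emeasurable_funM => //; apply/measurable_EFinP; apply: measurable_funTS.
  move=> u _; rewrite patchE mem_setE in_itv/=; case: ifPn => u01.
    apply: (le_trans (slice _ u01)); rewrite -EFinM lee_fin.
    rewrite /A powRM ?mulr_ge0 ?invr_ge0 ?powR_ge0// -powRrM mulNr.
    by rewrite (mulrC (1 + _)) mulrAC.
  by rewrite integral0_eq// => w _; rewrite /h/= (negbTE u01).
rewrite ge0_integralZl//; last 3 first.
- by apply/measurable_EFinP; apply: measurable_funTS.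
- by move=> u _; rewrite lee_fin powR_ge0.
- by rewrite lee_fin mulr_ge0 ?powR_ge0.
rewrite JE -EFinM lee_fin powRM ?invr_ge0// -powR_inv1// -powRrM mulN1r.
by rewrite le_eqVlt; apply/orP; left; apply/eqP; ring.
Qed.

End wstar_mean.

(** * Equality in law *)

Section bounded_expectations.
Context {R : realType} {d : measure_display} {T : measurableType d}.
Variable P : probability T R.

Lemma bounded_integrable (g : T -> R) (M : R) :
  measurable_fun [set: T] g -> (forall w, `|g w| <= M) ->
  P.-integrable [set: T] (EFin \o g).
Proof.
move=> mg gM; apply: measurable_bounded_integrable => //.
  by rewrite [X in (X < _)%E]probability_setT ltry.
by exists M; split; [exact: num_real|move=> x Mx w _; exact: le_trans (gM w) (ltW Mx)].
Qed.

Lemma integral_bounded_cvg (Y : nat -> T -> R) (Z : T -> R) (f : R -> R) (M : R) :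
  (forall k, measurable_fun [set: T] (Y k)) ->
  (forall w, Y k w @[k --> \oo] --> Z w) ->
  continuous f -> (forall x, `|f x| <= M) ->
  (\int[P]_w (f (Y k w))%:E @[k --> \oo] --> \int[P]_w (f (Z w))%:E)%E.
Proof.
move=> mY YZ cf fM.
have mf : measurable_fun [set: R] f by exact: continuous_measurable_fun.
apply: (@dominated_cvg _ _ _ P setT measurableT _ _ (cst M%:E)) => //.
- by move=> k; apply/measurable_EFinP; exact: measurableT_comp.
- move=> w _; apply: cvg_EFin; first exact: nearW.
  by apply: continuous_cvg; [exact: cf|exact: YZ].
- exact: finite_measure_integrable_cst.
- by move=> k w _; rewrite lee_fin.
Qed.

End bounded_expectations.

Section same_law.
Context {R : realType} {d d' : measure_display}
  {T : measurableType d} {T' : measurableType d'}.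
Variables (P : probability T R) (P' : probability T' R).

(** The test functions are those of weak convergence, so that equality in law
    passes to pointwise limits and transfers weak limits directly. Measurability
    is included because these limits have to be measurable as well. *)
Definition same_law (Y : T -> R) (Y' : T' -> R) : Prop :=
  [/\ measurable_fun [set: T] Y, measurable_fun [set: T'] Y' &
    forall f : R -> R, continuous f -> (exists M, forall x, `|f x| <= M) ->
      (\int[P]_w (f (Y w))%:E = \int[P']_w (f (Y' w))%:E)%E].

(** Dominated convergence on both sides. *)
Lemma same_law_cvg (Y : nat -> T -> R) (Y' : nat -> T' -> R) Z Z' :
  (forall k, same_law (Y k) (Y' k)) ->
  (forall w, Y k w @[k --> \oo] --> Z w) ->
  (forall w, Y' k w @[k --> \oo] --> Z' w) ->
  same_law Z Z'.
Proof.
move=> YY' YZ YZ'; split.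
- by apply: (measurable_fun_cvg (h := Y)) => [k|w _]; [case: (YY' k)|exact: YZ].
- by apply: (measurable_fun_cvg (h := Y')) => [k|w _]; [case: (YY' k)|exact: YZ'].
move=> f cf [M fM].
have mY k : measurable_fun [set: T] (Y k) by case: (YY' k).
have mY' k : measurable_fun [set: T'] (Y' k) by case: (YY' k).
have h := integral_bounded_cvg (P := P) mY YZ cf fM.
have h' := integral_bounded_cvg (P := P') mY' YZ' cf fM.
rewrite -(cvg_lim _ h)// -(cvg_lim _ h')//; congr lim.
suff -> : (fun k => \int[P]_w (f (Y k w))%:E)%E =
  (fun k => \int[P']_w (f (Y' k w))%:E)%E by [].
by apply/funext => k; have [_ _ ->] := YY' k; last by exists M.
Qed.

Lemma same_law_comp (g : R -> R) (Y : T -> R) (Y' : T' -> R) : continuous g ->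
  same_law Y Y' -> same_law (g \o Y) (g \o Y').
Proof.
move=> cg [mY mY' YY'].
have mg : measurable_fun [set: R] g by exact: continuous_measurable_fun.
split; [exact: measurableT_comp|exact: measurableT_comp|].
move=> f cf [M fM]; apply: (YY' (f \o g)).
  by move=> x; apply: continuous_comp; [exact: cg|exact: cf].
by exists M => x; exact: fM.
Qed.

Lemma eq_distribution_integral d1 (U : measurableType d1)
    (Y : T -> U) (Y' : T' -> U) (g : U -> R) (M : R) :
  measurable_fun [set: T] Y -> measurable_fun [set: T'] Y' ->
  (forall A, measurable A -> P (Y @^-1` A) = P' (Y' @^-1` A)) ->
  measurable_fun [set: U] g -> (forall x, `|g x| <= M) ->
  (\int[P]_w (g (Y w))%:E = \int[P']_w (g (Y' w))%:E)%E.
Proof.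
move=> mY mY' YY' mg gM.
have mEg : measurable_fun [set: U] (EFin \o g) by exact/measurable_EFinP.
have h := @integral_distribution _ _ _ _ _ P (RV_of P mY) _ mEg.
have h' := @integral_distribution _ _ _ _ _ P' (RV_of P' mY') _ mEg.
rewrite -[LHS]h; last first.
  by apply: (@bounded_integrable _ _ _ _ _ M) => //; exact: measurableT_comp.
rewrite -[RHS]h'; last first.
  by apply: (@bounded_integrable _ _ _ _ _ M) => //; exact: measurableT_comp.
by apply: eq_measure_integral => A mA _; exact: YY'.
Qed.

End same_law.

(** Inverse sampling: the quantile function of [nu] transforms a uniform variable
    into a variable with law [nu]. *)
Lemma inverse_sampling {R : realType} {d} {T : measurableType d}
    (P : probability T R) (U : T -> R) (nu : probability R R) :
  measurable_fun [set: T] U -> (forall w, 0 < U w < 1) ->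
  (forall x, 0 < x < 1 -> P [set w | U w <= x] = x%:E) ->
  exists2 V : T -> R, measurable_fun [set: T] V &
    forall A, measurable A -> P (V @^-1` A) = nu A.
Proof.
move=> mU U01 Ux.
pose G := dist_fun nu; pose V w := quantile G (U w).
have VE y : [set w | V w <= y] = [set w | U w <= G y].
  by apply/seteqP; split => w /=; rewrite /V dist_fun_quantile_le.
have mV : measurable_fun [set: T] V.
  apply: measurable_fun_sublevel => y; rewrite VE.
  rewrite -[X in measurable X]setTI; apply: measurable_fun_le => //.
exists V => // A mA.
apply: (eq_dist_fun_measure (nu1 := distribution P (RV_of P mV))) => //.
apply/funext => y.
have -> : dist_fun (distribution P (RV_of P mV)) y = fine (P [set w | U w <= G y]).
  rewrite /dist_fun /distribution /pushforward; congr (fine (P _)).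
  by rewrite -VE; apply/seteqP; split => w; rewrite /= in_itv.
have [Gy0|Gy0] := leP (G y) 0.
  rewrite (_ : mkset _ = set0); last first.
    apply/seteqP; split => // w /= /le_trans/(_ Gy0).
    by have /andP[U0 _] := U01 w; rewrite leNgt U0.
  by rewrite measure0/=; apply/eqP; rewrite eq_sym eq_le Gy0 dist_fun_ge0.
have [Gy1|Gy1] := ltP (G y) 1; first by rewrite Ux ?Gy0.
rewrite (_ : mkset _ = setT); last first.
  apply/seteqP; split => // w _ /=; apply: le_trans Gy1.
  by have /andP[_ /ltW] := U01 w.
by rewrite probability_setT/=; apply/eqP; rewrite eq_le Gy1 dist_fun_le1.
Qed.

(** * Brownian motion on a grid *)

Section independent_vectors.
Context {R : realType} {d d' : measure_display}
  {T : measurableType d} {T' : measurableType d'}.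
Variables (P : probability T R) (P' : probability T' R) (k : nat).

Definition vec_of {S : Type} (D : 'I_k -> S -> R) (w : S) : k.-tuple R :=
  [tuple D i w | i < k].

Lemma measurable_vec_of d1 (S : measurableType d1) (D : 'I_k -> S -> R) :
  (forall i, measurable_fun [set: S] (D i)) -> measurable_fun [set: S] (vec_of D).
Proof.
move=> mD; apply/measurable_fun_tnthP => i.
rewrite (_ : _ \o _ = D i)//.
by apply/funext => w; rewrite /= /vec_of tnth_mktuple.
Qed.

Let rectangles : set (set (k.-tuple R)) :=
  [set S | exists A : 'I_k -> set R, (forall i, measurable (A i)) /\
     S = [set t | forall i, A i (tnth t i)]].

Let rect_prob d1 (S : measurableType d1) (Q : probability S R) (D : 'I_k -> S -> R)
    (A : 'I_k -> set R) :
  mutually_independent Q D -> (forall i, measurable (A i)) ->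
  Q (vec_of D @^-1` [set t | forall i, A i (tnth t i)]) =
    (\prod_(i < k) Q (D i @^-1` A i))%E.
Proof.
move=> iD mA; have := iD (index_enum 'I_k) A (index_enum_uniq _) mA.
move=> <-; congr (Q _); apply/seteqP; split => w /=.
  by move=> h i _; have := h i; rewrite tnth_mktuple.
by move=> h i; rewrite tnth_mktuple; apply: h; rewrite /= mem_index_enum.
Qed.

(** Independence and the marginal laws determine the probabilities of the
    measurable rectangles, a pi-system that generates the product sigma-algebra. *)
Lemma eq_independent_distribution (D : 'I_k -> T -> R) (D' : 'I_k -> T' -> R) :
  (forall i, measurable_fun [set: T] (D i)) ->
  (forall i, measurable_fun [set: T'] (D' i)) ->
  mutually_independent P D -> mutually_independent P' D' ->
  (forall i A, measurable A -> P (D i @^-1` A) = P' (D' i @^-1` A)) ->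
  forall S, measurable S -> P (vec_of D @^-1` S) = P' (vec_of D' @^-1` S).
Proof.
move=> mD mD' iD iD' DD' S mS.
have mV := measurable_vec_of mD; have mV' := measurable_vec_of mD'.
have mrect : rectangles `<=` measurable.
  move=> _ [A [mA ->]].
  rewrite (_ : mkset _ = \bigcap_(i in [set: 'I_k]) ((@tnth _ _)^~ i @^-1` A i)).
    apply: fin_bigcap_measurable => // i _; rewrite -[X in measurable X]setTI.
    exact: (measurable_tnth i measurableT (mA i)).
  by apply/seteqP; split => t /= h i; [move=> _|]; exact: h.
apply: (@g_sigma_algebra_measure_unique _ R _ rectangles mrect (fun=> setT) _ _
  (distribution P (RV_of P mV)) (distribution P' (RV_of P' mV'))).
- move=> _; exists (fun=> setT); split => //.
  by apply/seteqP; split.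
- by apply/seteqP; split => // t _; exists 0%N.
- move=> _ _ [A [mA ->]] [A' [mA' ->]]; exists (fun i => A i `&` A' i); split.
    by move=> i; exact: measurableI.
  apply/seteqP; split => t /=; first by move=> [h h'] i.
  by move=> h; split => i; have [] := h i.
- move=> _ [A [mA ->]].
  transitivity (\prod_(i < k) P (D i @^-1` A i))%E; first exact: (rect_prob iD mA).
  transitivity (\prod_(i < k) P' (D' i @^-1` A i))%E; last first.
    exact/esym/(rect_prob iD' mA).
  by apply: eq_bigr => i _; exact: DD'.
- by move=> _; rewrite -ge0_fin_numE// fin_num_measure.
move: mS; apply: sub_smallest2r.
  exact: smallest_sigma_algebra.
apply: (big_ind (fun X => X `<=` rectangles)) => //.
  by move=> X Y XG YG A [/XG|/YG].
move=> i _ _ [A mA <-]; exists (fun j => if j == i then A else setT); split.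
  by move=> j; case: ifP.
apply/seteqP; split => t /=.
  by move=> [_ At] j; case: eqP => // ->.
by move=> h; split => //; have := h i; rewrite eqxx.
Qed.

End independent_vectors.

Section brownian_grid.
Context {R : realType}.

Let grid (k i : nat) : R := i%:R / k%:R.

Let telescope (a : nat -> R) (k i : nat) : (i <= k)%N ->
  \sum_(j < k | (j < i)%N) (a j.+1 - a j) = a i - a 0%N.
Proof.
move=> ik; rewrite -(telescope_sumr a (leq0n i)) big_mkord.
exact/esym/(big_ord_widen k (fun j => a j.+1 - a j) ik).
Qed.

Variable (k : nat).
Hypothesis k0 : (0 < k)%N.

(** Expressed in the increments [x], since these are independent: the value of
    the path at the [i]-th grid point is the sum of the first [i] increments. *)
Let path_sum (f : R -> R) (a : nat -> R) (x : k.-tuple R) : R :=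
  f (\sum_(i < k) a i * (\sum_(j < k | (j < i)%N) tnth x j) ^+ 2).

Let measurable_path_sum f a : measurable_fun [set: R] f ->
  measurable_fun [set: k.-tuple R] (path_sum f a).
Proof.
move=> mf; apply: (measurableT_comp mf); apply: measurable_sum => i.
apply: measurable_funM => //; apply: measurable_funX.
have -> : (fun x : k.-tuple R => \sum_(j < k | (j < i)%N) tnth x j) =
    (fun x => \sum_(j < k) if (j < i)%N then tnth x j else 0).
  by apply/funext => x; rewrite big_mkcond.
apply: measurable_sum => j; case: (j < i)%N => //.
exact: measurable_tnth.
Qed.

Let grid01 i : (i <= k)%N -> 0 <= grid k i <= 1.
Proof.
move=> ik; rewrite divr_ge0//= ler_pdivrMr ?ltr0n// mul1r ler_nat//.
Qed.

Let increments {S : Type} (B : R -> S -> R) (i : 'I_k) (w : S) : R :=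
  B (grid k i.+1) w - B (grid k i) w.

Let integral_grid d (T : measurableType d) (P : probability T R)
    (B : R -> {RV P >-> R}) (f : R -> R) (a : nat -> R) :
  standard_brownian_motion P B -> measurable_fun [set: R] f ->
  (\int[P]_w (f (\sum_(i < k) a i * B (grid k i) w ^+ 2))%:E =
   \int[P]_w (path_sum f a (vec_of (increments B) w))%:E)%E.
Proof.
move=> BM mf; apply: ae_eq_integral => //.
- apply/measurable_EFinP; apply: (measurableT_comp mf).
  by apply: measurable_sum => i; apply: measurable_funM => //; apply: measurable_funX.
- apply/measurable_EFinP.
  apply: (measurableT_comp (measurable_path_sum a mf)).
  by apply: measurable_vec_of => i; exact: measurable_funB.
have [N [mN N0 BN]] := brownian_start BM.
exists N; split => // w /= H; apply: BN => /= B0; apply: H => _.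
rewrite /path_sum; congr ((f _)%:E); apply: eq_bigr => i _.
congr (_ * _ ^+ 2).
under eq_bigr do rewrite tnth_mktuple /increments.
rewrite (telescope (fun j => B (grid k j) w) (ltnW (ltn_ord i))).
by rewrite /grid mul0r B0 subr0.
Qed.

(** Almost surely, the sum is a function of the vector of the increments, whose
    law is the same for both Brownian motions. *)
Lemma brownian_grid_law d d' (T : measurableType d) (T' : measurableType d')
    (P : probability T R) (P' : probability T' R)
    (B : R -> {RV P >-> R}) (B' : R -> {RV P' >-> R}) (a : nat -> R) :
  standard_brownian_motion P B -> standard_brownian_motion P' B' ->
  same_law P P' (fun w => \sum_(i < k) a i * B (grid k i) w ^+ 2)
                (fun w => \sum_(i < k) a i * B' (grid k i) w ^+ 2).
Proof.
move=> BM BM'; split.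
- by apply: measurable_sum => i; apply: measurable_funM => //; apply: measurable_funX.
- by apply: measurable_sum => i; apply: measurable_funM => //; apply: measurable_funX.
move=> f cf [M fM].
have mf : measurable_fun [set: R] f by exact: continuous_measurable_fun.
rewrite [LHS](integral_grid a BM mf) [RHS](integral_grid a BM' mf).
have mD d1 (S : measurableType d1) (Q : probability S R) (C : R -> {RV Q >-> R}) i :
  measurable_fun [set: S] (increments C i) by exact: measurable_funB.
have iD d1 (S : measurableType d1) (Q : probability S R) (C : R -> {RV Q >-> R}) :
    standard_brownian_motion Q C -> mutually_independent Q (increments C).
  move=> CM; apply: (brownian_indep CM (t := grid k)); first exact: grid01.
  by move=> i ik; rewrite ler_pM2r ?invr_gt0 ?ltr0n// ler_nat.
have nD d1 (S : measurableType d1) (Q : probability S R) (C : R -> {RV Q >-> R}) :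
    standard_brownian_motion Q C -> forall (i : 'I_k) A, measurable A ->
    Q (increments C i @^-1` A) =
    normal_prob 0 (Num.sqrt (grid k i.+1 - grid k i)) A.
  move=> CM i A mA; apply: (brownian_normal CM) => //.
  - by rewrite divr_ge0.
  - by rewrite ltr_pM2r ?invr_gt0 ?ltr0n// ltr_nat.
  - by have /andP[] := grid01 (ltn_ord i).
apply: (@eq_distribution_integral _ _ _ _ _ _ _ _ _ _ _ (path_sum f a) M).
- by apply: measurable_vec_of => i; exact: mD.
- by apply: measurable_vec_of => i; exact: mD.
- apply: eq_independent_distribution => //.
  + exact: iD.
  + exact: iD.
  + by move=> i A mA; rewrite (nD _ _ _ _ BM)// (nD _ _ _ _ BM').
- exact: measurable_path_sum.
- by move=> x; exact: fM.
Qed.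

End brownian_grid.

(** * Riemann sums *)

Section riemann_sums.
Context {R : realType}.
Variables (phi : R -> R) (M : R).
Hypothesis phi_ge0 : forall u, 0 <= u <= 1 -> 0 <= phi u.
Hypothesis phi_leM : forall u, 0 <= u <= 1 -> phi u <= M.
Hypothesis phi_cont : forall (u : R) (t : nat -> R), 0 < u <= 1 ->
  (forall n, 0 <= t n <= 1) -> t n @[n --> \oo] --> u ->
  phi (t n) @[n --> \oo] --> phi u.

(** Cells open on the left and sampled at their left end point: they tile
    ]0, 1], and [phi] is allowed to be discontinuous at 0. *)
Let cell n i : set R := `]i%:R / n.+1%:R, i.+1%:R / n.+1%:R]%classic.

Let step n u : R := \sum_(i < n.+1) phi (i%:R / n.+1%:R) * \1_(cell n i) u.

Let grid01 n (i : 'I_n.+1) : 0 <= (i%:R : R) / n.+1%:R <= 1.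
Proof.
rewrite divr_ge0//= ler_pdivrMr ?ltr0n// mul1r ler_nat.
by rewrite ltnW.
Qed.

Let stepP n u : 0 < u <= 1 -> exists t : R,
  [/\ 0 <= t <= 1, `|u - t| <= n.+1%:R^-1 & step n u = phi t].
Proof.
move=> /andP[u0 u1]; have nR : 0 < n.+1%:R :> R by rewrite ltr0n.
have ex : exists m, u <= m%:R / n.+1%:R.
  by exists n.+1; rewrite divff// gt_eqF.
(* The cell of [u] ends at the least grid point above [u]. *)
have [m um mmin] := find_ex_minn ex.
have m0 : (0 < m)%N.
  by rewrite lt0n; apply/eqP => m0; move: um; rewrite m0 mul0r leNgt u0.
have mn : (m <= n.+1)%N by apply: mmin; rewrite divff// gt_eqF.
have pm : (m.-1 < n.+1)%N by rewrite prednK.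
have lo : m.-1%:R / n.+1%:R < u.
  by rewrite ltNge; apply/negP => /mmin; rewrite leqNgt prednK// leqnn.
exists (m.-1%:R / n.+1%:R); split; first exact: (grid01 (Ordinal pm)).
  rewrite gtr0_norm ?subr_gt0// lerBlDr (le_trans um)//.
  by rewrite -{1}(prednK m0) -natr1 mulrDl mul1r addrC.
rewrite /step (bigD1 (Ordinal pm))//= big1 ?addr0.
  rewrite indicE mem_set ?mulr1// /cell /= in_itv/= lo.
  by rewrite prednK.
move=> i im; rewrite indicE memNset ?mulr0// /cell /= in_itv/= => /andP[h1 h2].
move/eqP: im; apply; apply/val_inj => /=.
apply/eqP; rewrite eqn_leq; apply/andP; split.
  rewrite -ltnS prednK// -(ltr_nat R).
  by rewrite -(@ltr_pM2r _ n.+1%:R^-1) ?invr_gt0// (lt_le_trans h1).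
by have := mmin _ h2; case: (m) m0.
Qed.

Let measurable_step n : measurable_fun [set: R] (step n).
Proof.
apply: measurable_sum => i; apply: measurable_funM => //.
by apply: measurable_indic; exact: measurable_itv.
Qed.

Let step_cvg u : 0 < u <= 1 -> step n u @[n --> \oo] --> phi u.
Proof.
move=> u01.
have /choice[t tP] : forall n, exists t : R,
    [/\ 0 <= t <= 1, `|u - t| <= n.+1%:R^-1 & step n u = phi t].
  by move=> n; exact: stepP.
rewrite (_ : (fun n => step n u) = phi \o t); last first.
  by apply/funext => n; have [_ _] := tP n.
apply: phi_cont => // [n|]; first by have [] := tP n.
apply/cvgrPdist_le => e e0; near=> n.
have [_ h _] := tP n; apply: (le_trans h).
by near: n; apply: filterS (near_infty_natSinv_lt (PosNum e0)) => n /ltW.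
Unshelve. all: by end_near. Qed.

Lemma measurable_riemann_limit :
  measurable_fun (`]0, 1]%classic : set R) phi.
Proof.
apply: (measurable_fun_cvg (h := step)) => [n|u];
  first exact: (measurable_funTS (measurable_step n)).
by rewrite /= in_itv/=; exact: step_cvg.
Qed.

Let integral_step n :
  (\int[lebesgue_measure]_(u in `]0%R, 1%R]) (step n u)%:E =
   (\sum_(i < n.+1) n.+1%:R^-1 * phi (i%:R / n.+1%:R))%:E)%E.
Proof.
have nR : 0 < n.+1%:R :> R by rewrite ltr0n.
rewrite /step; under eq_integral do rewrite -sumEFin.
rewrite ge0_integral_sum//=; last 2 first.
- move=> i; apply/measurable_EFinP/measurable_funTS/measurable_funM => //.
  by apply: measurable_indic; exact: measurable_itv.
- by move=> i u _; rewrite lee_fin mulr_ge0// ?phi_ge0 ?indicE.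
rewrite -sumEFin; apply: eq_bigr => i _.
under eq_integral do rewrite EFinM.
rewrite ge0_integralZl//=; last 2 first.
- apply/measurable_EFinP/measurable_funTS.
  by apply: measurable_indic; exact: measurable_itv.
- by rewrite lee_fin phi_ge0.
rewrite integral_indic//=; last exact: measurable_itv.
rewrite setIidl; last first.
  move=> u; rewrite /cell /= !in_itv/= => /andP[h1 h2].
  have /andP[g0 _] := grid01 i.
  rewrite (le_lt_trans g0 h1)/= (le_trans h2)//.
  by rewrite ler_pdivrMr// mul1r ler_nat.
rewrite /cell lebesgue_measure_itv/= lte_fin.
rewrite ltr_pM2r ?invr_gt0// ltr_nat ltnSn -EFinB -EFinM; congr (_%:E).
by rewrite -mulrBl -natrB// subSnn mul1r mulrC.
Qed.

Let unit_measure :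
  lebesgue_measure (`]0%R, 1%R]%classic : set (measurableTypeR R)) = 1%E.
Proof. by rewrite lebesgue_measure_itv/= lte_fin ltr01 sube0. Qed.

(** The Riemann sum is the integral of a step function that samples [phi] within
    the mesh of [u]; dominated convergence applies. *)
Lemma riemann_sum_cvg :
  (\int[lebesgue_measure]_(u in `]0%R, 1%R]) (phi u)%:E \is a fin_num)%E /\
  \sum_(i < n.+1) n.+1%:R^-1 * phi (i%:R / n.+1%:R) @[n --> \oo] -->
  fine (\int[lebesgue_measure]_(u in `]0%R, 1%R]) (phi u)%:E)%E.
Proof.
have h : (\int[lebesgue_measure]_(u in `]0%R, 1%R]) (step n u)%:E @[n --> \oo] -->
          \int[lebesgue_measure]_(u in `]0%R, 1%R]) (phi u)%:E)%E.
  apply: (@dominated_cvg _ (measurableTypeR R) R lebesgue_measure _ _ _ _ (cst M%:E)) => //.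
  - by move=> n; apply/measurable_EFinP; exact: (measurable_funTS (measurable_step n)).
  - move=> u; rewrite /= in_itv/= => u01; apply: cvg_EFin; first exact: nearW.
    exact: step_cvg.
  - apply: (@measurable_bounded_integrable _ (measurableTypeR R)) => //.
      by rewrite [X in (X < _)%E]unit_measure ltry.
    by exists `|M|; split; [exact: num_real|move=> x Mx u _; exact: ltW].
  - move=> n u; rewrite /= in_itv/= => u01; have [t [t01 _ ->]] := stepP n u01.
    by rewrite lee_fin ger0_norm ?phi_ge0 ?phi_leM.
have fin : (\int[lebesgue_measure]_(u in `]0%R, 1%R]) (phi u)%:E \is a fin_num)%E.
  rewrite ge0_fin_numE; last first.
    apply: integral_ge0 => u; rewrite /= in_itv/= => /andP[u0 u1].
    by rewrite lee_fin phi_ge0// (ltW u0).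
  apply: (@le_lt_trans _ _ (\int[lebesgue_measure]_(u in `]0%R, 1%R]) (cst M%:E) u)%E).
    apply: ge0_le_integral => //.
    - move=> u; rewrite /= in_itv/= => /andP[u0 u1].
      by rewrite lee_fin phi_ge0// (ltW u0).
    - by apply/measurable_EFinP; exact: measurable_riemann_limit.
    - move=> u; rewrite /= in_itv/= => /andP[u0 u1].
      by rewrite lee_fin phi_leM// (ltW u0).
  by rewrite integral_cst// [X in (_ * X)%E]unit_measure mule1 ltry.
split => //.
move: h; under eq_fun do rewrite integral_step.
by rewrite -[X in _ --> X -> _]fineK// => /fine_cvg.
Qed.

End riemann_sums.

(** * The weighted Brownian integral *)

Lemma cvg_minr {R : realType} (x : nat -> R) (l r : R) :
  x n @[n --> \oo] --> l -> Num.min (x n) r @[n --> \oo] --> Num.min l r.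
Proof.
move=> xl; rewrite minr_absE; under eq_fun do rewrite minr_absE.
apply: cvgM; last exact: cvg_cst.
apply: cvgB; first by apply: cvgD => //; exact: cvg_cst.
by apply: cvg_norm; apply: cvgB => //; exact: cvg_cst.
Qed.

Section weighted_path.
Context {R : realType}.
Variables (p : R) (b : R -> R).
Hypothesis cb : {within `[0, 1], continuous b}.

(** The cut-off makes the integrand bounded on [0, 1] even if the weight is
    singular at 0, and it increases to the integrand as [m] grows, whatever the
    sign of the exponent. *)
Definition cut_integrand (q : R) (a : R -> R) (m : nat) (u : R) : R :=
  (Num.min (u `^ q) m%:R * a u) ^+ 2.

Let g := cut_integrand p b.

Let b_bounded : exists2 M, 0 <= M & forall u, 0 <= u <= 1 -> `|b u| <= M.
Proof.
have [x1 _ h1] := EVT_max ler01 cb; have [x2 _ h2] := EVT_min ler01 cb.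
exists (Num.max `|b x1| `|b x2|); first by rewrite le_max normr_ge0.
move=> u u01; rewrite ler_norml; apply/andP; split.
  rewrite lerNl le_max; apply/orP; right.
  rewrite -normrN (le_trans _ (ler_norm _))// lerN2.
  by apply: h2; rewrite in_itv.
rewrite le_max; apply/orP; left; rewrite (le_trans _ (ler_norm _))//.
by apply: h1; rewrite in_itv.
Qed.

Lemma continuous_path_seq (u : R) (t : nat -> R) : 0 <= u <= 1 ->
  (forall n, 0 <= t n <= 1) -> t n @[n --> \oo] --> u ->
  b (t n) @[n --> \oo] --> b u.
Proof.
move=> u01 t01 tu.
have /subspace_continuousP/(_ u) h := cb.
have {}h : b x @[x --> within `[0, 1]%classic (nbhs u)] --> b u.
  by apply: h; rewrite /= in_itv.
apply: (cvg_comp t b _ h) => A /= nA.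
have : \forall n \near \oo, `[0, 1]%classic (t n) -> A (t n) by exact: (tu _ nA).
by apply: filterS => n; apply; rewrite /= in_itv/=.
Qed.

Let riemann_hyps m : exists M, [/\ forall u, 0 <= u <= 1 -> 0 <= g m u,
  forall u, 0 <= u <= 1 -> g m u <= M & forall (u : R) (t : nat -> R), 0 < u <= 1 ->
  (forall n, 0 <= t n <= 1) -> t n @[n --> \oo] --> u ->
  g m (t n) @[n --> \oo] --> g m u].
Proof.
have [M M0 bM] := b_bounded; exists ((m%:R * M) ^+ 2); split.
- by move=> u _; exact: sqr_ge0.
- move=> u u01; rewrite -ler_sqrt ?sqr_ge0//.
  rewrite !sqrtr_sqr normrM [leRHS]ger0_norm ?mulr_ge0//.
  rewrite ler_pM// ?bM// ger0_norm; first by rewrite ge_min lexx orbT.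
  by rewrite le_min powR_ge0/=.
- move=> u t /andP[u0 u1] t01 tu; apply: (@cvgM _ _ _ _ (fun n => _) (fun n => _));
    apply: cvgM.
  + apply: cvg_minr; apply: (cvg_comp t (fun x => x `^ p) tu).
    exact: continuous_powR_gt0.
  + by apply: continuous_path_seq; rewrite // (ltW u0).
  + apply: cvg_minr; apply: (cvg_comp t (fun x => x `^ p) tu).
    exact: continuous_powR_gt0.
  + by apply: continuous_path_seq; rewrite // (ltW u0).
Qed.

Definition cut_integral (q : R) (a : R -> R) (m : nat) : \bar R :=
  (\int[lebesgue_measure]_(u in `]0%R, 1%R]) (cut_integrand q a m u)%:E)%E.

Lemma cut_integral_fin m : cut_integral p b m \is a fin_num.
Proof.
have [M [h1 h2 h3]] := riemann_hyps m.
by have [] := riemann_sum_cvg h1 h2 h3.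
Qed.

Lemma cut_integral_riemann m :
  \sum_(i < n.+1) n.+1%:R^-1 * cut_integrand p b m (i%:R / n.+1%:R)
    @[n --> \oo] --> fine (cut_integral p b m).
Proof.
have [M [h1 h2 h3]] := riemann_hyps m.
by have [] := riemann_sum_cvg h1 h2 h3.
Qed.

Let measurable_g m : measurable_fun (`]0, 1]%classic : set R) (g m).
Proof.
have [M [h1 h2 h3]] := riemann_hyps m.
exact: (measurable_riemann_limit h3).
Qed.

(** Monotone convergence; the limit may be infinite. *)
Lemma cut_integral_cvg :
  (cut_integral p b m @[m --> \oo] -->
   \int[lebesgue_measure]_(u in `]0%R, 1%R[) ((u `^ p * b u) ^+ 2)%:E)%E.
Proof.
have gcvg (u : R) : (g m u)%:E @[m --> \oo] --> ((u `^ p * b u) ^+ 2)%:E.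
  apply: cvg_EFin; first exact: nearW.
  apply: cvg_near_cst; near=> m; rewrite /g /cut_integrand /= min_l//.
  near: m; exact: nbhs_infty_ger.
have mG : measurable_fun (`]0%R, 1%R]%classic : set R)
    (fun u => ((u `^ p * b u) ^+ 2)%:E).
  apply: (emeasurable_fun_cvg (fun m u => (g m u)%:E)) => [m|u _]; last exact: gcvg.
  by apply/measurable_EFinP.
have -> : (\int[lebesgue_measure]_(u in `]0%R, 1%R[) ((u `^ p * b u) ^+ 2)%:E =
   \int[lebesgue_measure]_(u in `]0%R, 1%R]) limn (fun m => (g m u)%:E))%E.
  rewrite integral_itv_bndo_bndc.
    by apply: eq_integral => u _; apply/esym/cvg_lim => //; exact: gcvg.
  by apply: (measurable_funS _ _ mG); [exact: measurable_itv|exact: subset_itv_oo_oc].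
apply: (@cvg_monotone_convergence _ (measurableTypeR R) R lebesgue_measure) => //.
- by move=> m; apply/measurable_EFinP; exact: (measurable_g m).
- by move=> m u _; rewrite lee_fin sqr_ge0.
move=> u _ m n mn; rewrite lee_fin /g /cut_integrand !exprMn.
have min0 k : 0 <= Num.min (u `^ p) k%:R by rewrite le_min powR_ge0/=.
rewrite ler_wpM2r ?sqr_ge0// lerXn2r ?nnegrE//.
by rewrite le_min !ge_min lexx/= ler_nat mn orbT.
Unshelve. all: by end_near. Qed.

End weighted_path.

Section damping.
Context {R : realType}.

(** The real value [fine L] of an infinite integral [L] is 0, hence it is not a
    continuous function of [L]. Damping restores continuity: [damp e] tends to 0
    at infinity, which is also its value at 0, and it tends to the identity as
    [e] decreases to 0. *)
Definition damp (e x : R) : R := x / (1 + e * x ^+ 2).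

Let den_gt0 (e x : R) : 0 <= e -> 0 < 1 + e * x ^+ 2.
Proof. by move=> e0; rewrite ltr_wpDr// mulr_ge0// sqr_ge0. Qed.

Lemma continuous_damp e : 0 <= e -> continuous (damp e).
Proof.
move=> e0 x; apply: cvgM; first exact: cvg_id.
apply: cvgV; first by rewrite gt_eqF// den_gt0.
apply: cvgD; first exact: cvg_cst.
by apply: cvgM; [exact: cvg_cst|exact: exprn_continuous].
Qed.

Lemma damp_cvg_id x : damp k.+1%:R^-1 x @[k --> \oo] --> x.
Proof.
rewrite [X in _ --> X](_ : x = x / (1 + 0 * x ^+ 2)); last first.
  by rewrite mul0r addr0 divr1.
apply: cvgM; first exact: cvg_cst.
apply: cvgV; first by rewrite mul0r addr0 oner_neq0.
apply: cvgD; first exact: cvg_cst.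
apply: cvgM; last exact: cvg_cst.
exact: cvg_harmonic.
Qed.

Lemma damp_cvg_pinfty e (y : nat -> R) : 0 < e ->
  y m @[m --> \oo] --> +oo -> damp e (y m) @[m --> \oo] --> 0.
Proof.
move=> e0 yoo.
apply: (@squeeze_cvgr _ _ _ _ (cst 0) (fun m => e^-1 * (y m)^-1)).
- have h : \forall m \near \oo, 0 < y m by exact: (cvgryPgt _).1.
  near=> m; have ym : 0 < y m by near: m.
  rewrite /damp divr_ge0 ?(ltW ym) ?(ltW (den_gt0 _ (ltW e0)))//=.
  rewrite ler_pdivrMr; last exact/den_gt0/ltW.
  rewrite mulrDr mulr1 [X in _ + X](_ : _ = y m).
    by rewrite lerDr mulr_ge0// invr_ge0 ltW.
  by field; rewrite !gt_eqF.
- exact: cvg_cst.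
- rewrite -[X in _ --> X](mulr0 e^-1); apply: cvgM; first exact: cvg_cst.
  apply/gtr0_cvgV0 => //.
  exact: (cvgryPgt _).1.
Unshelve. all: by end_near. Qed.

Lemma damp_fine_cvg e (J : nat -> \bar R) (L : \bar R) : 0 < e ->
  (forall m, J m \is a fin_num) -> (0 <= L)%E -> J m @[m --> \oo] --> L ->
  damp e (fine (J m)) @[m --> \oo] --> damp e (fine L).
Proof.
move=> e0 Jfin; case: L => [l| |]// _ JL.
- apply: continuous_cvg; first exact/continuous_damp/ltW.
  exact: fine_cvg.
- rewrite [fine _]/= {2}/damp mul0r; apply: damp_cvg_pinfty => //.
  have JE : J = (fun m => (fine (J m))%:E) by apply/funext => m; rewrite fineK.
  by apply/cvgeryP; rewrite JE in JL.
Qed.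

End damping.

Section weighted_brownian.
Context {R : realType} {d d' : measure_display}
  {T : measurableType d} {T' : measurableType d'}.
Variables (P : probability T R) (P' : probability T' R).
Variables (B : R -> {RV P >-> R}) (B' : R -> {RV P' >-> R}).

(** The weighted integral is an iterated pointwise limit of functions of the path
    on a grid: Riemann sums converge to the integrals with a cut-off weight,
    these converge to the full integral in the extended reals, and damping is
    removed last. Equality in law is preserved at each stage. *)
Lemma weighted_brownian_law (alpha c : R) :
  standard_brownian_motion P B -> standard_brownian_motion P' B' ->
  same_law P P' (weighted_brownian_integral alpha c (fun u w => B u w))
                (weighted_brownian_integral alpha c (fun u w => B' u w)).
Proof.
move=> BM BM'; pose p := alpha^-1 - 1.
pose Jlim d0 (S : measurableType d0) (C : R -> S -> R) w : \bar R :=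
  (\int[lebesgue_measure]_(u in `]0%R, 1%R[) ((u `^ p * C u w) ^+ 2)%:E)%E.
have cB : forall w, {within `[0, 1], continuous (fun u => B u w)}.
  exact: brownian_continuous BM.
have cB' : forall w, {within `[0, 1], continuous (fun u => B' u w)}.
  exact: brownian_continuous BM'.
have lawJm m : same_law P P' (fun w => fine (cut_integral p (fun u => B u w) m))
    (fun w => fine (cut_integral p (fun u => B' u w) m)).
  apply: same_law_cvg => [n|w|w]; last 2 first.
  - exact: (cut_integral_riemann (cB w)).
  - exact: (cut_integral_riemann (cB' w)).
  have := brownian_grid_law (ltn0Sn n)
    (fun i => n.+1%:R^-1 * (Num.min ((i%:R / n.+1%:R) `^ p) m%:R) ^+ 2) BM BM'.
  congr (same_law _ _ _ _); apply/funext => w; apply: eq_bigr => i _.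
    by rewrite /cut_integrand -mulrA -exprMn.
  by rewrite /cut_integrand -mulrA -exprMn.
have lawD e : 0 < e ->
    same_law P P' (fun w => damp e (fine (Jlim _ _ (fun u => B u) w)))
      (fun w => damp e (fine (Jlim _ _ (fun u => B' u) w))).
  move=> e0; apply: same_law_cvg => [m|w|w]; last 2 first.
  - apply: damp_fine_cvg => //; last exact: (cut_integral_cvg (cB w)).
    + by move=> m; exact: (cut_integral_fin p (cB w)).
    + by apply: integral_ge0 => u _; rewrite lee_fin sqr_ge0.
  - apply: damp_fine_cvg => //; last exact: (cut_integral_cvg (cB' w)).
    + by move=> m; exact: (cut_integral_fin p (cB' w)).
    + by apply: integral_ge0 => u _; rewrite lee_fin sqr_ge0.
  apply: (@same_law_comp _ _ _ _ _ _ _ (damp e)); last exact: lawJm.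
  exact/continuous_damp/ltW.
have lawJ : same_law P P' (fun w => fine (Jlim _ _ (fun u => B u) w))
    (fun w => fine (Jlim _ _ (fun u => B' u) w)).
  apply: same_law_cvg => [k|w|w]; last 2 first.
  - exact: damp_cvg_id.
  - exact: damp_cvg_id.
  by apply: lawD; rewrite invr_gt0.
apply: (@same_law_comp _ _ _ _ _ _ _ (fun x => c ^+ 2 * x) _ _ _ lawJ).
by move=> x; apply: cvgM; [exact: cvg_cst|exact: cvg_id].
Qed.

End weighted_brownian.

(** * The dominating sequence *)

Section perturbation.
Context {R : realType} {d : measure_display} {T : measurableType d}.
Variable P : probability T R.

Lemma Rintegral_perturb_le (g1 g2 : T -> R) (M : R) (A : set T) :
  measurable A -> measurable_fun [set: T] g1 -> measurable_fun [set: T] g2 ->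
  (forall w, `|g1 w| <= M) -> (forall w, `|g2 w| <= M) ->
  (forall w, ~ A w -> g1 w = g2 w) ->
  (`|\int[P]_w g1 w - \int[P]_w g2 w|%:E <= (2 * M)%:E * P A)%E.
Proof.
move=> mA mg1 mg2 g1M g2M g12.
have i1 : P.-integrable [set: T] (EFin \o g1) by exact: bounded_integrable g1M.
have i2 : P.-integrable [set: T] (EFin \o g2) by exact: bounded_integrable g2M.
have mg : measurable_fun [set: T] (fun w => g1 w - g2 w) by exact: measurable_funB.
have gM w : `|g1 w - g2 w| <= 2 * M.
  by rewrite mulr_natl mulr2n (le_trans (ler_normB _ _))// lerD.
have ig : P.-integrable [set: T] (EFin \o (fun w => g1 w - g2 w)).
  exact: bounded_integrable gM.
rewrite -RintegralB// EFin_normr_Rintegral//.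
apply: (@le_trans _ _ (\int[P]_w `|(g1 w - g2 w)%:E|)%E).
  by apply: le_abse_integral => //; exact/measurable_EFinP.
apply: (@le_trans _ _ (\int[P]_w ((2 * M)%:E * (\1_A w)%:E))%E).
  apply: ge0_le_integral => //=.
  - by apply/measurable_EFinP; exact: measurableT_comp.
  - by apply/measurable_EFinP/measurable_funM => //; exact: measurable_indic.
  move=> w _; rewrite -EFinM lee_fin indicE; case: (boolP (w \in A)) => wA.
    by rewrite mulr1.
  by move: wA; rewrite notin_setE mulr0 => /g12 ->; rewrite subrr normr0.
rewrite integralZl//; last first.
  by apply/integrable_indic.
by rewrite integral_indic// setIT.
Qed.

(** Taking the maximum of the error with [delta n] makes the perturbation of [V]
    deterministic outside of an event of vanishing probability; for the
    deterministic shift, [f (V + delta n)] converges pointwise because [f] is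
    continuous. *)
Lemma cvg_law_max_error (V : T -> R) (a : nat -> T -> R) (delta q : nat -> R)
    (f : R -> R) (M : R) :
  measurable_fun [set: T] V -> (forall n, measurable_fun [set: T] (a n)) ->
  delta n @[n --> \oo] --> 0 -> q n @[n --> \oo] --> 0 ->
  (\forall n \near \oo, P [set w | (delta n < a n w)%R] <= (q n)%:E)%E ->
  continuous f -> (forall x, `|f x| <= M) ->
  (\int[P]_w (f (V w + Num.max (a n w) (delta n)))%:E @[n --> \oo] -->
   \int[P]_w (f (V w))%:E)%E.
Proof.
move=> mV ma delta0 q0 Pq cf fM.
have M0 : 0 <= M by exact: le_trans (normr_ge0 _) (fM 0).
have mf : measurable_fun [set: R] f by exact: continuous_measurable_fun.
pose Y n w := V w + Num.max (a n w) (delta n).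
pose Z n w := V w + delta n.
have mY n : measurable_fun [set: T] (Y n).
  by apply: measurable_funD => //; exact: measurable_maxr.
have mZ n : measurable_fun [set: T] (Z n) by exact: measurable_funD.
have iY n : P.-integrable [set: T] (EFin \o (f \o Y n)).
  by apply: (@bounded_integrable _ _ _ _ _ M (measurableT_comp mf (mY n))) => w; exact: fM.
have iZ n : P.-integrable [set: T] (EFin \o (f \o Z n)).
  by apply: (@bounded_integrable _ _ _ _ _ M (measurableT_comp mf (mZ n))) => w; exact: fM.
have iV : P.-integrable [set: T] (EFin \o (f \o V)).
  by apply: (@bounded_integrable _ _ _ _ _ M (measurableT_comp mf mV)) => w; exact: fM.
have hZ : (\int[P]_w (f (Z n w))%:E @[n --> \oo] --> \int[P]_w (f (V w))%:E)%E.
  apply: (integral_bounded_cvg mZ _ cf fM) => w.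
  rewrite -[X in _ --> X](addr0 (V w)); apply: cvgD => //; exact: cvg_cst.
have RE (g : T -> R) : P.-integrable [set: T] (EFin \o g) ->
    (\int[P]_w (g w)%:E = (\int[P]_w g w)%:E)%E.
  by move=> ig; rewrite /Rintegral fineK//; exact: integrable_fin_num.
rewrite (RE (f \o V))// in hZ *.
apply: cvg_EFin.
  by apply: nearW => n; exact: (integrable_fin_num _ (iY n)).
have {}hZ : \int[P]_w f (Z n w) @[n --> \oo] --> \int[P]_w f (V w).
  exact: (fine_cvg hZ).
have err : \int[P]_w f (Y n w) - \int[P]_w f (Z n w) @[n --> \oo] --> 0.
  apply/norm_cvg0P; apply: (@squeeze_cvgr _ _ _ _ (cst 0) (fun n => 2 * M * q n)).
  - near=> n; rewrite normr_ge0/= -lee_fin.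
    have mA : measurable [set w | delta n < a n w] by exact: measurable_superlevel.
    apply: (le_trans (@Rintegral_perturb_le (f \o Y n) (f \o Z n) M _ mA _ _ _ _ _)) => //.
    + exact: (measurableT_comp mf (mY n)).
    + exact: (measurableT_comp mf (mZ n)).
    + by move=> w; exact: fM.
    + by move=> w; exact: fM.
    + move=> w /= /negP; rewrite -leNgt => h; by rewrite /Y /Z max_r.
    + rewrite [leRHS]EFinM lee_wpmul2l// ?lee_fin ?mulr_ge0//.
      by near: n.
  - exact: cvg_cst.
  - by rewrite -[X in _ --> X](mulr0 (2 * M)); apply: cvgM; [exact: cvg_cst|exact: q0].
suff : \int[P]_w f (Y n w) @[n --> \oo] --> \int[P]_w f (V w) by [].
rewrite (_ : (fun n => _) = (fun n =>
    (\int[P]_w f (Y n w) - \int[P]_w f (Z n w)) + \int[P]_w f (Z n w))).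
  by rewrite -[X in _ --> X]add0r; exact: cvgD.
by apply/funext => n; rewrite subrK.
Unshelve. all: by end_near. Qed.

End perturbation.

Lemma markov_le {R : realType} {d} {T : measurableType d} (P : probability T R)
    (a : T -> R) (delta m : R) :
  measurable_fun [set: T] a -> (forall w, 0 <= a w) -> 0 < delta ->
  (\int[P]_w (a w)%:E <= m%:E -> P [set w | (delta < a w)%R] <= (m / delta)%:E)%E.
Proof.
move=> ma a0 de0 am; set A := [set w | _].
have mA : measurable A by exact: measurable_superlevel.
rewrite EFinM lee_pdivlMr//; apply: le_trans am.
have <- : (\int[P]_w (\1_A w)%:E = P A)%E by rewrite integral_indic// setIT.
rewrite muleC -ge0_integralZl//=; last 2 first.
- by apply/measurable_EFinP/measurable_indic.
- by rewrite lee_fin ltW.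
apply: ge0_le_integral => //=.
- by move=> w _; rewrite -EFinM lee_fin mulr_ge0 ?(ltW de0)//.
- by apply/measurable_EFinP/measurable_funM => //; exact: measurable_indic.
- exact/measurable_EFinP.
move=> w _; rewrite -EFinM lee_fin indicE; case: (boolP (w \in A)) => [|_].
  by rewrite inE mulr1 => /ltW.
by rewrite mulr0.
Qed.

Section pareto_uniform.
Context {R : realType}.
Variables (alpha c : R) (alpha0 : 0 < alpha) (c0 : 0 < c).
Variable mu : probability R R.
Hypothesis mu_density : forall A : set R, measurable A ->
  mu A = (\int[lebesgue_measure]_(x in A) (neg_pareto_pdf alpha c x)%:E)%E.
Context {d : measure_display} {Omega : measurableType d}.
Variables (P : probability Omega R) (X : {RV P >-> R}).
Hypothesis X_law : forall A : set R, measurable A -> distribution P X A = mu A.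

Let F := dist_fun mu.

Let FE y : y < - c -> F y = (c / - y) `^ alpha.
Proof. exact: (dist_fun_pareto alpha0 c0 mu_density). Qed.

Let dist_fun_lt y z : y < z -> z < - c -> F y < F z.
Proof.
move=> yz zc; have z0 : 0 < - z by rewrite oppr_gt0 (lt_trans zc)// oppr_lt0.
have yz' : - z < - y by rewrite ltrN2.
have y0 : 0 < - y by exact: lt_trans yz'.
rewrite !FE ?(lt_trans yz)// gt0_ltr_powR ?nnegrE ?(ltW (divr_gt0 _ _))//.
by rewrite ltr_pM2l// ltf_pV2.
Qed.

(** The probability integral transform, redefined on the null set where the
    distribution function is 1 to take its values in the open unit interval. *)
Lemma pareto_uniform : exists U : Omega -> R,
  [/\ measurable_fun [set: Omega] U, forall w, 0 < U w < 1 &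
    forall x, 0 < x < 1 -> P [set w | U w <= x] = x%:E].
Proof.
pose psi y : R := if y < - c then F y else 2^-1.
have mpsi : measurable_fun [set: R] psi.
  apply: measurable_fun_ifT => //; first exact: measurable_fun_ltr.
  by apply: nondecreasing_measurable => //; exact: dist_fun_homo.
exists (psi \o X); split; first exact: measurableT_comp.
  move=> w; rewrite /= /psi; case: ifPn => [xc|_].
    have x0 : 0 < - X w by rewrite oppr_gt0 (lt_trans xc)// oppr_lt0.
    rewrite FE// powR_gt0 ?divr_gt0//=.
    have <- : 1 `^ alpha = 1 :> R by rewrite powR1.
    rewrite gt0_ltr_powR ?nnegrE ?(ltW (divr_gt0 _ _))//.
    by rewrite ltr_pdivrMr// mul1r ltrNr.
  by rewrite invr_gt0 ltr0n/= invf_lt1 ?ltr0n// ltr1n.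
move=> x x01; pose q := quantile F x.
have Fq : F q = x by exact: (dist_fun_quantile_pareto alpha0 c0 mu_density).
have mS : measurable [set y | psi y <= x].
  rewrite -[X in measurable X]setTI; exact: measurable_fun_le.
have qc : q < - c.
  rewrite ltNge; apply/negP => /(dist_fun_pareto1 mu_density).
  by rewrite -/F Fq => x1; move: x01; rewrite x1 ltxx andbF.
transitivity (mu [set y | psi y <= x]); first by rewrite -X_law.
transitivity (mu `]-oo, q]%classic); last by rewrite dist_funE -/F Fq.
rewrite mu_density; last exact: mS.
rewrite mu_density; last exact: measurable_itv.
(* The two events differ only where the density vanishes. *)
rewrite integral_mkcond [RHS]integral_mkcond; apply: eq_integral => y _.
rewrite !patchE /neg_pareto_pdf; have [yc|cy] := ltP y (- c); last by rewrite !if_same.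
suff -> : (y \in [set y | psi y <= x]) = (y \in `]-oo, q]%classic) by [].
apply/idP/idP; rewrite !inE /= in_itv/= /psi yc.
  move=> Fyx; rewrite leNgt; apply/negP => /dist_fun_lt/(_ yc).
  by rewrite Fq ltNge Fyx.
by move=> yq; rewrite -Fq; exact: dist_fun_homo.
Qed.

End pareto_uniform.

Section domination.
Context {R : realType}.
Variables (alpha c : R) (alpha0 : 0 < alpha) (c0 : 0 < c).
Variable mu : probability R R.
Hypothesis mu_density : forall A : set R, measurable A ->
  mu A = (\int[lebesgue_measure]_(x in A) (neg_pareto_pdf alpha c x)%:E)%E.
Context {d : measure_display} {Omega : measurableType d}.
Variables (P : probability Omega R) (X : nat -> {RV P >-> R}).
Hypothesis X_indep : mutually_independent P (fun (i : nat) (w : Omega) => X i w).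
Hypothesis X_law : forall (i : nat) (A : set R), measurable A ->
  distribution P (X i) A = mu A.

Let wstar_ge0 n w : 0 <= wstar mu (X ^~ w) n.
Proof. by apply: Rintegral_ge0 => u _; exact: sqr_ge0. Qed.

(** With [kappa < theta < alpha / (alpha + 2)] and [eta] half of the gap between
    [kappa] and [theta], Markov's inequality shows that the rescaled statistic
    exceeds [n^-eta] with probability at most a multiple of
    [n^(kappa - theta + eta) = n^-eta]. *)
Lemma dominating_sequence (kappa : R) (V : Omega -> R) :
  0 < kappa -> kappa < alpha / (alpha + 2) ->
  measurable_fun [set: Omega] V -> (forall w, 0 <= V w) ->
  exists E : nat -> {RV P >-> R},
    [/\ forall (n : nat) (w : Omega), 0 <= E n w,
        forall (n : nat) (w : Omega), (0 < n)%N ->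
          n%:R `^ kappa * wstar mu (fun i => X i w) n <= E n w &
        forall f : R -> R, continuous f -> (exists M, forall x, `|f x| <= M) ->
          (\int[P]_w (f (E n w))%:E @[n --> \oo] --> \int[P]_w (f (V w))%:E)%E].
Proof.
move=> kappa0 kappa_lt mV V0.
pose theta := (kappa + alpha / (alpha + 2)) / 2.
have kt : kappa < theta by rewrite ltr_pdivlMr// mulr_natr mulr2n ltrD2l.
have t01 : 0 < theta < alpha / (alpha + 2).
  by rewrite (lt_trans kappa0)//= ltr_pdivrMr// mulr_natr mulr2n ltrD2r.
have [M M0 wM] := mean_wstar_le alpha0 c0 mu_density X_indep X_law t01.
pose eta := (theta - kappa) / 2.
have eta0 : 0 < eta by rewrite divr_gt0// subr_gt0.
pose a n w := if (0 < n)%N then n%:R `^ kappa * wstar mu (X ^~ w) n else 0.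
pose delta n : R := n%:R `^ (- eta).
have a0 n w : 0 <= a n w.
  by rewrite /a; case: ifP => // _; rewrite mulr_ge0 ?powR_ge0.
have ma n : measurable_fun [set: Omega] (a n).
  rewrite /a; case: ltnP => // n0; apply: measurable_funM => //.
  exact: (measurable_wstar alpha0 c0 mu_density).
have mE n : measurable_fun [set: Omega] (fun w => V w + Num.max (a n w) (delta n)).
  by apply: measurable_funD => //; exact: measurable_maxr.
exists (fun n => RV_of P (mE n)); split.
- by move=> n w /=; rewrite addr_ge0// le_max a0.
- move=> n w n0 /=; rewrite (@le_trans _ _ (a n w))//; first by rewrite /a n0.
  by rewrite (@le_trans _ _ (Num.max (a n w) (delta n)))// ?lerDr// le_max lexx.
move=> f cf [Mf fM] /=.
have delta0 : delta n @[n --> \oo] --> 0.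
  exact: (cvg_comp _ _ cvgr_idn (cvg_powRN_pinfty eta0)).
apply: (@cvg_law_max_error _ _ _ P V a delta (fun n => M * delta n)) => //.
- by rewrite -[X in _ --> X](mulr0 M); apply: cvgM; [exact: cvg_cst|exact: delta0].
near=> n; have n0 : (0 < n)%N by near: n; exists 1%N.
have nR : 0 < n%:R :> R by rewrite ltr0n.
have d0 : 0 < delta n by rewrite powR_gt0.
have -> : M * delta n = n%:R `^ kappa * (M * n%:R `^ (- theta)) / delta n.
  transitivity (M * (n%:R `^ kappa * n%:R `^ (- theta) * n%:R `^ eta)).
    congr (_ * _); rewrite /delta -!powRD; [|by rewrite (gt_eqF nR) implybT..].
    by have -> : kappa - theta + eta = - eta by rewrite /eta; lra.
  by rewrite /delta (powRN _ eta) invrK; ring.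
apply: markov_le => //.
rewrite /a n0; under eq_integral do rewrite EFinM.
rewrite ge0_integralZl//=; last 2 first.
- exact/measurable_EFinP/(measurable_wstar alpha0 c0 mu_density).
- by move=> w _; rewrite lee_fin.
by rewrite [leRHS]EFinM lee_wpmul2l ?lee_fin ?powR_ge0// wM.
Unshelve. all: by end_near. Qed.

End domination.

Lemma bounded_funP {R : realType} (f : R -> R) :
  bounded_fun f -> exists M, forall x, `|f x| <= M.
Proof.
move=> /pinfty_ex_gt0[M _ fM]; exists M => x.
exact: fM.
Qed.

Theorem theorem3p2 (R : realType) (alpha c : R) (alpha0 : 0 < alpha)
    (c0 : 0 < c) (mu : probability R R)
    (mu_density : forall A : set R, measurable A ->
       mu A = (\int[lebesgue_measure]_(x in A) (neg_pareto_pdf alpha c x)%:E)%E)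
    (d : measure_display) (Omega : measurableType d) (P : probability Omega R)
    (X : nat -> {RV P >-> R})
    (X_indep : mutually_independent P (fun (i : nat) (w : Omega) => X i w))
    (X_law : forall (i : nat) (A : set R), measurable A ->
       distribution P (X i) A = mu A)
    (kappa : R) (kappa0 : 0 < kappa) (kappa_lt : kappa < alpha / (alpha + 2)) :
  exists E : nat -> {RV P >-> R},
    [/\ forall (n : nat) (w : Omega), 0 <= E n w,
        forall n : nat, (0 < n)%N ->
          {ae P, forall w, n%:R `^ kappa * wstar mu (fun i => X i w) n <= E n w}
      & forall (d' : measure_display) (Omega' : measurableType d')
               (P' : probability Omega' R) (B : R -> {RV P' >-> R}),
          standard_brownian_motion P' B ->
          cvg_in_distribution P P' E
            (weighted_brownian_integral alpha c (fun u w => B u w))].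
Proof.
(* The sequence has to be chosen before the Brownian motion is given; by
   uniqueness in law, it may be built from one fixed Brownian motion. *)
pose BM_exists := exists (d0 : measure_display) (T0 : measurableType d0)
  (P0 : probability T0 R) (B0 : R -> {RV P0 >-> R}), standard_brownian_motion P0 B0.
have [[d0 [T0 [P0 [B0 BM0]]]]|noBM] := pselect BM_exists; last first.
  have mc : measurable_fun [set: Omega] (cst 0 : Omega -> R) by [].
  have [E [E0 Ew _]] := dominating_sequence alpha0 c0 mu_density X_indep X_law
    kappa0 kappa_lt mc (fun=> lexx _).
  exists E; split => // [n n0|d' Omega' P' B BM]; first by apply: aeW => w; exact: Ew.
  by exfalso; apply: noBM; exists d', Omega', P', B.
pose L0 := weighted_brownian_integral alpha c (fun u w => B0 u w).
have L0_ge0 w : 0 <= L0 w.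
  rewrite /L0 /weighted_brownian_integral mulr_ge0 ?sqr_ge0//.
  by apply: Rintegral_ge0 => u _; exact: sqr_ge0.
have [mL0 _ _] := weighted_brownian_law alpha c BM0 BM0.
have [U [mU U01 Ux]] := pareto_uniform alpha0 c0 mu_density (X_law 0%N).
have [V mV VL0] := inverse_sampling (distribution P0 (RV_of P0 mL0)) mU U01 Ux.
(* [V] is nonnegative only almost surely; its absolute value has the same law. *)
have mnV : measurable_fun [set: Omega] (Num.norm \o V) by exact: measurableT_comp.
have [E [E0 Ew EV]] := dominating_sequence alpha0 c0 mu_density X_indep X_law
  kappa0 kappa_lt mnV (fun w => normr_ge0 (V w)).
exists E; split => // [n n0|d' Omega' P' B BM]; first by apply: aeW => w; exact: Ew.
have [_ mL lawL] := weighted_brownian_law alpha c BM0 BM.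
split => // f cf /bounded_funP[M fM].
have mf : measurable_fun [set: R] f by exact: continuous_measurable_fun.
have -> : 'E_P'[f \o weighted_brownian_integral alpha c (fun u w => B u w)]%E =
    (\int[P]_w (f ((Num.norm \o V) w))%:E)%E.
  rewrite unlock /= -lawL//; last by exists M.
  transitivity (\int[P0]_w (f `|L0 w|)%:E)%E.
    by apply: eq_integral => w _; rewrite ger0_norm.
  apply/esym.
  apply: (@eq_distribution_integral _ _ _ _ _ _ _ _ _ V L0 (f \o Num.norm) M) => //.
  + exact: measurableT_comp.
  + by move=> x; exact: fM.
under eq_fun do rewrite unlock.
by apply: EV => //; exists M.
Qed.
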